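(* Consider SGD under conditions (C1)--(C3) (stated in the context), with learning rate $(\alpha_k)$ of one of the types (Constant), (Decay 1), (Decay 2), (Decay 3) described in the context, and let $\epsilon>0$. Put $$C_2:=\frac{L\sigma^2\alpha}{2-L\alpha},\quad D_1:=\frac{2(f(\boldsymbol\theta_0)-f_\star)}{\alpha(2-L\alpha)},\quad D_2:=\frac{T\alpha^2L\sigma^2}{2-L\alpha},$$ and use the batch size $$b^\star=\begin{cases}\dfrac{2C_2}{\epsilon^2}&\text{(Constant)}\\[2mm]\dfrac{(1-a)D_2}{a(1-2a)D_1}&\text{(Decay 1)}\\[2mm]\dfrac{D_2+1}{\epsilon^2}&\text{(Decay 2)}\\[2mm]\dfrac{2a^2D_2}{(1-a)(2a-1)D_1}&\text{(Decay 3)}\end{cases}$$ to compute the iteration complexity $\mathcal K_\epsilon$ and the SFO (stochastic first-order oracle) complexity $\mathcal N_\epsilon$ (defined in the context). Then the iteration and SFO complexities such that SGD is an $\epsilon$-approximation, i.e. $\min_{k\in\{0,\dots,K-1\}}\mathbb E[\|\nabla f(\boldsymbol\theta_k)\|^2]\le\epsilon^2$, are $$\bigl(\mathcal K_\epsilon(n,b^\star,\alpha_k,\Delta_0,L,\sigma^2),\ \mathcal N_\epsilon(n,b^\star,\alpha_k,\Delta_0,L,\sigma^2)\bigr)=\begin{cases}\left(O\left(\frac{1}{\epsilon^{2}}\right),\,O\left(\frac{1}{\epsilon^{4}}\right)\right)&\text{(Constant)}\\[1mm] \left(O\left(\frac{1}{\epsilon^{2/a}}\right),\,O\left(\frac{1}{\epsilon^{2/a}}\right)\right)&\text{(Decay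 1)}\\[1mm] \left(O\left(\frac{1}{\epsilon^{4}}\right),\,O\left(\frac{1}{\epsilon^{6}}\right)\right)&\text{(Decay 2)}\\[1mm] \left(O\left(\frac{1}{\epsilon^{2/(1-a)}}\right),\,O\left(\frac{1}{\epsilon^{2/(1-a)}}\right)\right)&\text{(Decay 3)}\end{cases}$$
   Context: Conditions. (C1) $f=\frac1n\sum_{i=1}^n f_i:\mathbb R^d\to\mathbb R$ is differentiable and $L$-smooth, i.e. $\|\nabla f(\boldsymbol x)-\nabla f(\boldsymbol y)\|\le L\|\boldsymbol x-\boldsymbol y\|$ for all $\boldsymbol x,\boldsymbol y$ (Euclidean norm), $f$ is bounded below by $f_\star\in\mathbb R$, and $\Delta_0>0$ satisfies $f(\boldsymbol\theta_0)-f_\star\le\Delta_0$, where $\boldsymbol\theta_0\in\mathbb R^d$ is an initial point. The class of such $f$ is denoted $\mathcal F(n,\Delta_0,L)$. (C2) A stochastic first-order oracle returns, at a point $\boldsymbol\theta$, a stochastic gradient $\mathsf G_\xi(\boldsymbol\theta)$ depending on a random variable $\xi$. The samples are independent, those drawn at iteration $k$ are independent of $\boldsymbol\theta_0,\dots,\boldsymbol\theta_k$, and each sample $\xi$ drawn at iteration $k$ satisfies $\mathbb E_\xi[\mathsf G_\xi(\boldsymbol\theta_k)]=\nabla f(\boldsymbol\theta_k)$ and $\mathbb E_\xi[\|\mathsf G_\xi(\boldsymbol\theta_k)-\nabla f(\boldsymbol\theta_k)\|^2]\le\sigma^2$ for a constant $\sigma^2\ge 0$. (C3) At each iteration $k$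 the algorithm draws $b$ samples $\xi_{k,1},\dots,\xi_{k,b}$, where the batch size $b\le n$ does not depend on $k$, and estimates the full gradient by $\nabla f_{B_k}(\boldsymbol\theta_k):=\frac1b\sum_{i=1}^b\mathsf G_{\xi_{k,i}}(\boldsymbol\theta_k)$. The class of stochastic first-order oracles satisfying (C2) and (C3) is denoted $\mathcal O(b,\sigma^2)$. SGD: $\boldsymbol\theta_{k+1}:=\boldsymbol\theta_k-\alpha_k\nabla f_{B_k}(\boldsymbol\theta_k)$, $k=0,1,2,\dots$ Learning rates, for a fixed $\alpha\in(0,2/L)$: (Constant) $\alpha_k=\alpha$ for all $k$. (Decay) $\alpha_k=\dfrac{\alpha}{(\lfloor k/T\rfloor+1)^a}$ with $T\ge1$, where (Decay 1) $a\in(0,\frac12)$; (Decay 2) $a=\frac12$; (Decay 3) $a\in(\frac12,1)$. Complexities. With $\mathbb E$ the total expectation, $$\mathcal K_\epsilon(n,b,\alpha_k,\Delta_0,L,\sigma^2):=\sup_{\mathsf O\in\mathcal O(b,\sigma^2)}\ \sup_{f\in\mathcal F(n,\Delta_0,L)}\inf\Bigl\{K:\min_{k\in\{0,\dots,K-1\}}\mathbb E[\|\nabla f(\boldsymbol\theta_k)\|]\le\epsilon\Bigr\},$$ $$\mathcal N_\epsilon(n,b,\alpha_k,\Delta_0,L,\sigma^2):=\mathcal K_\epsilon(n,b,\alpha_k,\Delta_0,L,\sigma^2)\,b.$$ Landau symbol: for $x(\epsilon),y(\epsilon)>0$, $y(\epsilon)=O(x(\epsilon))$ means there exists $c>0$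 such that $y(\epsilon)\le c\,x(\epsilon)$. *)

(* Defs.v *)
From HB Require Import structures.
From mathcomp Require Import all_boot all_order all_algebra.
From mathcomp Require Import all_classical all_reals all_analysis.
Set Implicit Arguments.
Unset Strict Implicit.
Unset Printing Implicit Defensive.
Import Order.TTheory GRing.Theory Num.Theory.
Import numFieldNormedType.Exports.
Local Open Scope classical_set_scope.
Local Open Scope ring_scope.

(* The library norm on 'rV[R]_d is the sup norm, hence this definition. *)
Definition enorm (R : realType) (d : nat) (x : 'rV[R]_d) : R :=
  Num.sqrt (\sum_(j < d) x 0 j ^+ 2).

Definition grad (R : realType) (d : nat) (f : 'rV[R]_d -> R) (x : 'rV[R]_d) :
    'rV[R]_d :=
  \row_(j < d) 'D_(delta_mx 0 j) f x.

Record objective (R : realType) (d n : nat) (Delta0 L : R) (theta0 : 'rV[R]_d)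
    (fstar : R) (f : 'rV[R]_d -> R) : Prop := Objective {
  obj_finite_sum : exists fi : 'I_n -> 'rV[R]_d -> R,
    forall x, f x = n%:R^-1 * \sum_(i < n) fi i x;
  obj_differentiable : forall x, differentiable f x;
  obj_smooth : forall x y, enorm (grad f x - grad f y) <= L * enorm (x - y);
  obj_lower_bound : forall x, fstar <= f x;
  obj_initial_gap : f theta0 - fstar <= Delta0 }.

(* R^d with its Borel sigma-algebra *)
Definition borel_rV (R : realType) (d : nat) :=
  g_sigma_algebraType (@open 'rV[R]_d).

Section sgd.
Context (R : realType) (d b : nat).
Context (dO dX : measure_display).
Context (Omega : measurableType dO) (Xi : measurableType dX).
Context (P : probability Omega R).
Context (G : Xi -> 'rV[R]_d -> 'rV[R]_d) (xi : nat -> 'I_b -> {RV P >-> Xi}).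

Definition batch_grad (k : nat) (w : Omega) (x : 'rV[R]_d) : 'rV[R]_d :=
  b%:R^-1 *: \sum_(i < b) G (xi k i w) x.

Fixpoint sgd (lr : nat -> R) (theta0 : 'rV[R]_d) (k : nat) (w : Omega) :
    'rV[R]_d :=
  if k is k'.+1 then
    sgd lr theta0 k' w - lr k' *: batch_grad k' w (sgd lr theta0 k' w)
  else theta0.

(* mutual independence of all the samples *)
Definition independent_samples : Prop :=
  forall (J : seq (nat * 'I_b)) (A : nat * 'I_b -> set Xi),
    uniq J -> (forall j, measurable (A j)) ->
    P (\big[setI/setT]_(j <- J) (xi j.1 j.2 @^-1` A j)) =
    (\prod_(j <- J) P (xi j.1 j.2 @^-1` A j))%E.

Definition sigma_samples (k : nat) : set (set Omega) :=
  <<s \bigcup_i preimage_set_system setT (xi k i) measurable >>.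

Definition sigma_iterates (theta : nat -> Omega -> 'rV[R]_d) (k : nat) :
    set (set Omega) :=
  <<s \bigcup_(j in [set j | (j <= k)%N])
        preimage_set_system setT (theta j : Omega -> borel_rV R d) measurable >>.

(* In the moment conditions the inner expectation E_xi is over a copy w' of the
   sample point, which varies only in xi: the iterate theta k w is held fixed,
   and the conditions are required for almost every w. *)
Record oracle (sigma2 : R) (f : 'rV[R]_d -> R)
    (theta : nat -> Omega -> 'rV[R]_d) : Prop := Oracle {
  oracle_measurable : measurable_fun setT
    (fun z : (Xi * borel_rV R d)%type => G z.1 z.2 : borel_rV R d);
  oracle_independent : independent_samples;
  oracle_independent_past : forall k A B,
    sigma_samples k A -> sigma_iterates theta k B ->
    P (A `&` B) = (P A * P B)%E;
  oracle_unbiased : forall k i, {ae P, forall w, forall j,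
    'E_P[fun w' => G (xi k i w') (theta k w) ord0 j]%E =
      (grad f (theta k w) ord0 j)%:E};
  oracle_variance : forall k i, {ae P, forall w,
    ('E_P[fun w' =>
       (enorm (G (xi k i w') (theta k w) - grad f (theta k w)) ^+ 2)%R]
     <= sigma2%:E)%E} }.

(* the least K such that min_{k < K} E[ |grad f (theta_k)|^p ] <= eps^p *)
Definition iterations (p : nat) (f : 'rV[R]_d -> R)
    (theta : nat -> Omega -> 'rV[R]_d) (eps : R) : \bar R :=
  ereal_inf [set K%:R%:E | K in [set K : nat |
    (\big[mine/+oo]_(k < K) 'E_P[fun w => (enorm (grad f (theta k w)) ^+ p)%R]
     <= (eps ^+ p)%R%:E)%E]].

End sgd.

Definition complexity (p : nat) (R : realType) (d : nat) (theta0 : 'rV[R]_d)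
    (n b : nat) (lr : nat -> R) (Delta0 L sigma2 eps : R) : \bar R :=
  ereal_sup [set y : \bar R |
    exists (dO dX : measure_display)
           (Omega : measurableType dO) (Xi : measurableType dX)
           (P : probability Omega R)
           (G : Xi -> 'rV[R]_d -> 'rV[R]_d) (xi : nat -> 'I_b -> {RV P >-> Xi})
           (f : 'rV[R]_d -> R) (fstar : R),
      let theta := sgd G xi lr theta0 in
      [/\ objective n Delta0 L theta0 fstar f,
          oracle G xi sigma2 f theta &
          y = iterations P p f theta eps]].

(* Worst-case number of iterations and of oracle calls for the criterion
   min_k E|grad f (theta_k)| <= eps. *)
Definition K_eps := complexity 1.

Definition N_eps (R : realType) (d : nat) (theta0 : 'rV[R]_d)
    (n b : nat) (lr : nat -> R) (Delta0 L sigma2 eps : R) : \bar R :=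
  (K_eps theta0 n b lr Delta0 L sigma2 eps * b%:R%:E)%E.

(* The same for an eps-approximation, min_k E|grad f (theta_k)|^2 <= eps^2. *)
Definition K_approx := complexity 2.

Definition N_approx (R : realType) (d : nat) (theta0 : 'rV[R]_d)
    (n b : nat) (lr : nat -> R) (Delta0 L sigma2 eps : R) : \bar R :=
  (K_approx theta0 n b lr Delta0 L sigma2 eps * b%:R%:E)%E.

Inductive schedule (R : realType) : Type :=
  | Constant
  | Decay1 of R & R
  | Decay2 of R
  | Decay3 of R & R.
Arguments Constant {R}.

Section schedule.
Context (R : realType).
Implicit Types (s : schedule R) (alpha L gap eps : R).

(* The arguments of a decay are T and a, with a = 1/2 implicit in Decay2. *)
Definition schedule_ok s : Prop :=
  match s with
  | Constant => True
  | Decay1 T a => 1 <= T /\ 0 < a < 2^-1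
  | Decay2 T => 1 <= T
  | Decay3 T a => 1 <= T /\ 2^-1 < a < 1
  end.

Definition decay_rate alpha (T a : R) (k : nat) : R :=
  alpha / ((Num.floor (k%:R / T))%:~R + 1) `^ a.

Definition learning_rate s alpha : nat -> R :=
  match s with
  | Constant => fun=> alpha
  | Decay1 T a => decay_rate alpha T a
  | Decay2 T => decay_rate alpha T 2^-1
  | Decay3 T a => decay_rate alpha T a
  end.

Definition C2 alpha L (sigma2 : R) : R := L * sigma2 * alpha / (2 - L * alpha).

Definition D1 alpha L gap : R := 2 * gap / (alpha * (2 - L * alpha)).

Definition D2 alpha L (sigma2 T : R) : R :=
  T * alpha ^+ 2 * L * sigma2 / (2 - L * alpha).

(* gap stands for f(theta_0) - f_star. *)
Definition bstar s alpha L (sigma2 : R) gap eps : R :=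
  match s with
  | Constant => 2 * C2 alpha L sigma2 / eps ^+ 2
  | Decay1 T a =>
      (1 - a) * D2 alpha L sigma2 T / (a * (1 - 2 * a) * D1 alpha L gap)
  | Decay2 T => (D2 alpha L sigma2 T + 1) / eps ^+ 2
  | Decay3 T a =>
      2 * a ^+ 2 * D2 alpha L sigma2 T
      / ((1 - a) * (2 * a - 1) * D1 alpha L gap)
  end.

(* bstar is a nonnegative real, whereas a batch has a positive integer number of
   samples: bstar is rounded up, and is unchanged if it is a positive integer. *)
Definition batch_size s alpha L (sigma2 : R) gap eps : nat :=
  maxn 1 `|Num.ceil (bstar s alpha L sigma2 gap eps)|%N.

Definition K_order s eps : R :=
  match s with
  | Constant => (eps ^+ 2)^-1
  | Decay1 _ a => (eps `^ (2 / a))^-1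
  | Decay2 _ => (eps ^+ 4)^-1
  | Decay3 _ a => (eps `^ (2 / (1 - a)))^-1
  end.

Definition N_order s eps : R :=
  match s with
  | Constant => (eps ^+ 4)^-1
  | Decay1 _ a => (eps `^ (2 / a))^-1
  | Decay2 _ => (eps ^+ 6)^-1
  | Decay3 _ a => (eps `^ (2 / (1 - a)))^-1
  end.

(* y = O(x) on A, with a constant uniform over A *)
Definition bigO_on (I : Type) (A : set I) (y : I -> \bar R) (x : I -> R) : Prop :=
  exists2 c : R, 0 < c & forall i, A i -> (y i <= (c * x i)%:E)%E.

End schedule.

(* Main.v *)
(* With [g_k] the gradient of [f] at [theta_k], the batch gradient is
   [g_k + e_k] and the descent inequality for L-smooth functions bounds [f(theta_(k+1))] by
     f(theta_k) - a_k (1 - L a_k / 2) |g_k|^2 - (a_k - L a_k^2) <e_k, g_k>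
       + (L a_k^2 / 2) |e_k|^2.
   As the samples are independent of the iterates and of each other, Fubini
   gives E <e_k, g_k> = 0 and E |e_k|^2 <= sigma2 / b. Summing over [k < K],
     (1 - L alpha / 2) (sum a_k) min_k E |g_k|^2
       <= Delta0 + (L sigma2 / 2b) sum a_k^2.
   With [sum a_k >= alpha K^(1-a)] and [sum a_k^2 = O(K^(1-2a))] (which becomes
   [O(1)] if [a > 1/2], and is replaced by [O(K^(1/4))] instead of [O(log K)] if
   [a = 1/2]), it remains to choose [K] proportional to the claimed order. The
   criterion on [E |g_k|] follows from the one on [E |g_k|^2] by AM-GM. *)
Require Import Defs.
From HB Require Import structures.
From mathcomp Require Import all_boot all_order all_algebra.
From mathcomp Require Import all_classical all_reals all_analysis.
From mathcomp Require Import measurable_realfun ring lra.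
Set Implicit Arguments.
Unset Strict Implicit.
Unset Printing Implicit Defensive.
Import Order.TTheory GRing.Theory Num.Theory.
Import numFieldNormedType.Exports.
Local Open Scope classical_set_scope.
Local Open Scope ring_scope.

(** * Euclidean geometry and the descent inequality *)

Definition dotv (R : realType) (d : nat) (x y : 'rV[R]_d) : R :=
  \sum_(j < d) x 0 j * y 0 j.

Section euclidean.
Context (R : realType) (d : nat).
Implicit Types (x y z : 'rV[R]_d) (c : R).

Lemma enorm_ge0 x : 0 <= enorm x.
Proof. exact: sqrtr_ge0. Qed.

Lemma sqr_enorm x : enorm x ^+ 2 = dotv x x.
Proof. by rewrite sqr_sqrtr //; apply: sumr_ge0 => j _; exact: sqr_ge0. Qed.

Lemma dotvC x y : dotv x y = dotv y x.
Proof. by apply: eq_bigr => j _; rewrite mulrC. Qed.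

Lemma dotvDl x y z : dotv (x + y) z = dotv x z + dotv y z.
Proof. by rewrite -big_split; apply: eq_bigr => j _; rewrite mxE mulrDl. Qed.

Lemma dotvZl c x y : dotv (c *: x) y = c * dotv x y.
Proof. by rewrite mulr_sumr; apply: eq_bigr => j _; rewrite mxE mulrA. Qed.

Lemma dotvDr x y z : dotv z (x + y) = dotv z x + dotv z y.
Proof. by rewrite dotvC dotvDl !(dotvC z). Qed.

Lemma dotvZr c x y : dotv x (c *: y) = c * dotv x y.
Proof. by rewrite dotvC dotvZl dotvC. Qed.

Lemma dotvv_ge0 x : 0 <= dotv x x.
Proof. by rewrite -sqr_enorm sqr_ge0. Qed.

Lemma dotv_suml (I : finType) (u : I -> 'rV[R]_d) y :
  dotv (\sum_i u i) y = \sum_i dotv (u i) y.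
Proof.
rewrite /dotv exchange_big; apply: eq_bigr => j _.
by rewrite summxE mulr_suml.
Qed.

Lemma dotv_sumr (I : finType) (u : I -> 'rV[R]_d) y :
  dotv y (\sum_i u i) = \sum_i dotv y (u i).
Proof. by rewrite dotvC dotv_suml; apply: eq_bigr => i _; rewrite dotvC. Qed.

(** Both bounds come from expanding the squares of [x + y] and [x - y]. The right-hand side serves
    later as an integrable majorant. *)
Lemma norm_dotv_le x y : `|dotv x y| <= (enorm x ^+ 2 + enorm y ^+ 2) / 2.
Proof.
rewrite !sqr_enorm ler_norml; apply/andP; split.
  have := dotvv_ge0 (x + y); rewrite !(dotvDl, dotvDr) (dotvC y x); lra.
have := dotvv_ge0 (x + (-1) *: y).
rewrite !(dotvDl, dotvDr, dotvZl, dotvZr) (dotvC y x); lra.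
Qed.

(** This consequence of Cauchy-Schwarz follows directly from [|x - c y|^2 >= 0] and
    [|x|^2 <= c^2 |y|^2], after division by [2 c]. *)
Lemma dotv_le_of_enorm_le c x y : 0 < c -> enorm x <= c * enorm y ->
  dotv x y <= c * enorm y ^+ 2.
Proof.
move=> c0 xy.
have : enorm x ^+ 2 <= (c * enorm y) ^+ 2.
  by rewrite ler_sqr// nnegrE ?mulr_ge0 ?enorm_ge0// ltW.
have := dotvv_ge0 (x + (- c) *: y).
rewrite exprMn !(sqr_enorm, dotvDl, dotvDr, dotvZl, dotvZr) (dotvC y x) => h1 h2.
rewrite -(@ler_pM2l _ (2 * c)); last by rewrite mulr_gt0.
nra.
Qed.

End euclidean.

(** * Smooth functions: the descent inequality and its consequences *)

Section smooth.
Context (R : realType) (d : nat) (f : 'rV[R]_d -> R) (L : R).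
Hypothesis L_gt0 : 0 < L.
Hypothesis f_diff : forall x, differentiable f x.
Hypothesis grad_lip : forall x y, enorm (grad f x - grad f y) <= L * enorm (x - y).
Implicit Types x h : 'rV[R]_d.

(** The differential is linear, so expanding [h] in the standard basis leaves only the partial
    derivatives that define [grad]. *)
Lemma deriveE_dotv x h : 'D_h f x = dotv (grad f x) h.
Proof.
rewrite deriveE// {1}(row_sum_delta h) linear_sum /dotv.
apply: eq_bigr => j _.
by rewrite linearZ/= mxE -deriveE// [LHS]mulrC.
Qed.

Lemma is_derive_line x h (t : R) :
  is_derive t 1 (fun t : R => f (x + t *: h)) (dotv (grad f (x + t *: h)) h).
Proof.
have dl : is_diff t (fun t : R => x + t *: h) (0 + *:%R ^~ h) by exact: is_diffD.
have dc : differentiable (f \o (fun t : R => x + t *: h)) t.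
  exact: differentiable_comp.
apply: DeriveDef; first exact/derivable1_diffP.
rewrite deriveE// diff_comp//= -deriveE_dotv deriveE//; congr ('d f _ _).
rewrite diff_val fctE /=.
by rewrite scale1r add0r.
Qed.

Lemma descent x h :
  f (x + h) <= f x + dotv (grad f x) h + L / 2 * enorm h ^+ 2.
Proof.
(* [g] is [f] on the segment minus the linear and quadratic terms of the bound, so the claim is
   [g 1 <= g 0]. The Lipschitz condition makes the derivative of [g] nonpositive. *)
pose g t := f (x + t *: h) - t * dotv (grad f x) h - t ^+ 2 * (L / 2 * enorm h ^+ 2).
have dg (t : R) : is_derive t 1 g
   (dotv (grad f (x + t *: h)) h - dotv (grad f x) h - t * (L * enorm h ^+ 2)).
  have ? := is_derive_line x h t.
  rewrite /g; apply: is_derive_eq.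
  by rewrite /GRing.scale/=; field.
suff : g 1 <= g 0.
  rewrite /g !scale1r scale0r addr0 !mul0r !mul1r expr1n mul1r expr0n mul0r; lra.
apply: (@ler0_derive1_le_cc _ g 0 1); rewrite ?in_itv/= ?lexx ?ler01//.
- move=> t; rewrite in_itv/= => /andP[t0 t1].
  rewrite derive1E derive_val subr_le0.
  have e : (x + t *: h) - x = t *: h by rewrite addrC addKr.
  have h1 : enorm (grad f (x + t *: h) - grad f x) <= (L * t) * enorm h.
    apply: (le_trans (grad_lip _ _)); rewrite e -mulrA ler_pM2l//.
    have : enorm (t *: h) ^+ 2 = (t * enorm h) ^+ 2.
      by rewrite exprMn !sqr_enorm dotvZl dotvZr mulrA expr2.
    move/eqP; rewrite eqrXn2// ?enorm_ge0// ?mulr_ge0 ?enorm_ge0// ?(ltW t0)//.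
    by move/eqP => ->.
  have := dotv_le_of_enorm_le (mulr_gt0 L_gt0 t0) h1.
  by rewrite dotvDl -scaleN1r dotvZl mulN1r (mulrC L) -mulrA.
- apply: continuous_subspaceT => t.
  by apply: differentiable_continuous; apply/derivable1_diffP.
Qed.

Lemma descent_noisy_gradient x e (c : R) :
  f (x - c *: (grad f x + e)) <= f x - c * (1 - L * c / 2) * enorm (grad f x) ^+ 2
    - (c - L * c ^+ 2) * dotv e (grad f x) + L * c ^+ 2 / 2 * dotv e e.
Proof.
have := descent x (- c *: (grad f x + e)); rewrite scaleNr; move/le_trans; apply.
rewrite !sqr_enorm -scaleNr !(dotvZr, dotvZl, dotvDr, dotvDl) (dotvC (grad f x) e).
set p := dotv _ _; set q := dotv _ _; set r := dotv _ _.
by rewrite le_eqVlt; apply/orP; left; apply/eqP; field.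
Qed.

(** A gradient step of size [1/L] lowers [f] by at least [|grad f x|^2 / (2 L)], yet [f] cannot fall
    below [m]. This transfers integrability from the values of [f] to its squared gradient. *)
Lemma sqr_grad_le (m : R) x : (forall y, m <= f y) ->
  enorm (grad f x) ^+ 2 <= 2 * L * (f x - m).
Proof.
move=> fm; have := descent x (- L^-1 *: grad f x).
move: (fm (x + - L^-1 *: grad f x)); set y := f (_ + _).
rewrite !sqr_enorm !(dotvZl, dotvZr) => h1 h2.
have := le_trans h1 h2; set q := dotv _ _ => h3.
have e : - L^-1 * q + L / 2 * (- L^-1 * (- L^-1 * q)) = - (q / (2 * L)).
  by field; rewrite gt_eqF.
have : q / (2 * L) <= f x - m by lra.
by rewrite ler_pdivrMr ?mulr_gt0// mulrC.
Qed.

End smooth.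

(** * Borel vectors and independence *)

Section borel_vectors.
Context (R : realType) (d : nat).

Let box (c : 'rV[rat]_d * nat) : set 'rV[R]_d :=
  [set x | forall j, `|x 0 j - ratr (c.1 0 j)| < c.2.+1%:R^-1].

Let tri (e a b r t : R) :
  `|a - r| < t -> `|b - r| < t -> t < e / 2 -> `|a - b| < e.
Proof.
by rewrite !ltr_norml => /andP[? ?] /andP[? ?] ?; apply/andP; split; lra.
Qed.

(** Cubes with rational centre and radius [1/(n+1)] form a countable base of the topology; those not
    contained in [U] are replaced by the empty set. *)
Let open_box (U : set 'rV[R]_d) : open U ->
  U = \bigcup_c (if `[< box c `<=` U >] then box c else set0).
Proof.
move=> oU; apply/seteqP; split=> [x Ux|x [c _]]; last first.
  by case: asboolP => // + xc; exact.
have /nbhs_ballP[e /= e0 eU] : nbhs x U by exact: open_nbhs_nbhs.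
(* With a radius below [e/2], every cube containing [x] lies in the ball of radius [e] around
   [x]. *)
have [n ne] : exists n, n.+1%:R^-1 < e / 2 :> R.
  have e20 : 0 < e / 2 by rewrite divr_gt0.
  have /filter_ex[n ne] := near_infty_natSinv_lt (PosNum e20).
  by exists n.
have /choice[q xq] : forall j : 'I_d, exists q : rat,
    `|x 0 j - ratr q| < n.+1%:R^-1.
  move=> j; have [|q] := @rat_in_itvoo R (x 0 j - n.+1%:R^-1) (x 0 j + n.+1%:R^-1).
    by rewrite ltrBlDr -addrA ltrDl addr_gt0.
  by rewrite in_itv/= => xq; exists q; rewrite ltr_distlC.
exists (\row_j q j, n) => //.
have xb : box (\row_j q j, n) x by move=> j /=; rewrite mxE.
case: asboolP => // -[] y yb; apply: eU.
split => // i j; rewrite (ord1 i).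
rewrite /ball/=; apply: tri (xb j) (yb j) ne.
Qed.

(** The preimage of an open set is a countable union of preimages of rational cubes, and each of
    these is a finite intersection of conditions on single coordinates. *)
Lemma measurable_fun_coord dT (T : measurableType dT) (phi : T -> 'rV[R]_d) :
  (forall j, measurable_fun setT (fun t => phi t 0 j)) ->
  measurable_fun setT (phi : T -> borel_rV R d).
Proof.
move=> mphi; apply: (@measurability _ _ T (borel_rV R d) setT phi
  (@open 'rV[R]_d)) => // _ [U oU <-].
rewrite (open_box oU) setTI preimage_bigcup.
apply: countable_bigcupT_measurable => // c.
case: asboolP => _; last by rewrite preimage_set0.
rewrite [X in measurable X](_ : _ = \bigcap_(j in [set: 'I_d])
    ((phi^~ 0 : T -> 'I_d -> R)^~ j @^-1`
       [set r : R | `|r - ratr (c.1 0 j)| < c.2.+1%:R^-1])); last first.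
  by apply/seteqP; split=> [t + j _|t + j]; exact.
apply: fin_bigcap_measurable => [|j _]; first exact: finite_finset.
rewrite -[X in measurable X]setTI; apply: mphi => //.
apply: open_measurable.
rewrite (_ : [set r | _] = ball (ratr (c.1 0 j) : R) c.2.+1%:R^-1).
  exact: ball_open.
by apply/seteqP; split=> r /=; rewrite /ball/= distrC.
Qed.

Lemma continuous_borel_measurable (g : 'rV[R]_d -> R) :
  continuous g -> measurable_fun setT (g : borel_rV R d -> R).
Proof.
move=> /continuousP cg.
apply: (measurability _ (RGenOpens.measurableE R)) => _ [_ [a [b ->]] <-].
rewrite setTI; apply: sub_sigma_algebra; apply: cg; exact: interval_open.
Qed.

Lemma measurable_coord (j : 'I_d) :
  measurable_fun setT (fun x : borel_rV R d => (x : 'rV[R]_d) 0 j).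
Proof. apply: continuous_borel_measurable; exact: coord_continuous. Qed.

End borel_vectors.

(** * Independence and iterated integrals *)

Section independence.
Local Open Scope ereal_scope.
Context dO d1 d2 (Omega : measurableType dO) (T1 : measurableType d1)
  (T2 : measurableType d2) (R : realType) (P : probability Omega R).

Definition independent_pair (X : Omega -> T1) (Y : Omega -> T2) : Prop :=
  forall A B, measurable A -> measurable B ->
    P (X @^-1` A `&` Y @^-1` B) = P (X @^-1` A) * P (Y @^-1` B).

Variables (X : {RV P >-> T1}) (Y : {RV P >-> T2}).
Hypothesis XY : independent_pair X Y.

Let mXY : measurable_fun setT (fun w => (X w, Y w)).
Proof. exact: measurable_fun_pair. Qed.

Let Z : {RV P >-> (T1 * T2)%type} := HB.pack (fun w => (X w, Y w))
  (isMeasurableFun.Build _ _ _ _ _ mXY).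

(** Independence says that the joint law and the product of the laws agree on rectangles, which
    determines a product measure. *)
Let lawZ : forall C, measurable C ->
  (distribution P X \x distribution P Y) C = distribution P Z C.
Proof. by apply: product_measure_unique => A B mA mB; exact: XY. Qed.

(** This is Tonelli's theorem for the product law, pulled back to [Omega]. The inner integral runs
    over a copy [w'] with [Y] frozen, which is the form of the moment conditions of [oracle]. *)
Lemma ge0_integral_independent (h : T1 * T2 -> \bar R) :
  measurable_fun setT h -> (forall z, 0 <= h z) ->
  \int[P]_w h (X w, Y w) = \int[P]_w \int[P]_w' h (X w', Y w).
Proof.
move=> mh h0.
rewrite -[LHS]/(\int[P]_w (h \o Z) w) -ge0_integral_distribution//.
rewrite -(eq_measure_integral _ (fun C mC _ => lawZ mC)).
rewrite fubini_tonelli2// ge0_integral_distribution//.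
- apply: eq_integral => w _ /=; rewrite /fubini_G.
  rewrite (@ge0_integral_distribution _ _ _ _ _ _ X (fun x => h (x, Y w)))//.
  exact: measurable_fun_pair1.
- exact: measurable_fun_fubini_tonelli_G.
- by move=> y; exact: integral_ge0.
Qed.

Lemma measurable_integral_sample (h : T1 * T2 -> \bar R) :
  measurable_fun setT h -> (forall z, 0 <= h z) ->
  measurable_fun setT (fun w => \int[P]_w' h (X w', Y w)).
Proof.
move=> mh h0; rewrite (_ : (fun w => _) = fubini_G (distribution P X) h \o Y).
  by apply: measurableT_comp => //; exact: measurable_fun_fubini_tonelli_G.
apply/funext => w /=; rewrite /fubini_G.
rewrite (@ge0_integral_distribution _ _ _ _ _ _ X (fun x => h (x, Y w)))//.
exact: measurable_fun_pair1.
Qed.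

(** The positive and negative parts are integrated separately by Tonelli. Their inner integrals
    agree for almost every frozen [Y], hence so do the outer ones, and integrability allows the
    subtraction. *)
Lemma integral_independent_eq0 (h : T1 * T2 -> \bar R) :
  measurable_fun setT h ->
  P.-integrable setT (fun w => h (X w, Y w)) ->
  {ae P, forall w, \int[P]_w' h (X w', Y w) = 0} ->
  \int[P]_w h (X w, Y w) = 0.
Proof.
move=> mh hint h0.
have hp : measurable_fun setT (h^\+) by exact: measurable_funepos.
have hn : measurable_fun setT (h^\-) by exact: measurable_funeneg.
have pos_neg : \int[P]_w (h^\+ (X w, Y w)) = \int[P]_w (h^\- (X w, Y w)).
  rewrite (ge0_integral_independent hp)// (ge0_integral_independent hn)//.
  apply: ae_eq_integral => //.
  - exact: measurable_integral_sample.
  - exact: measurable_integral_sample.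
  apply: filterS h0 => w + _; rewrite integralE.
  rewrite (funepos_comp h (fun w' => (X w', Y w))).
  rewrite (funeneg_comp h (fun w' => (X w', Y w)))/= => /eqP.
  set a := integral _ _ _; set b := integral _ _ _.
  have a0 : 0 <= a by apply: integral_ge0.
  have b0 : 0 <= b by apply: integral_ge0.
  (* Since [+oo - +oo] is [-oo], a zero difference forces both integrals to be finite and equal. *)
  move: a b a0 b0 => [a| |] [b| |]//= _ _.
  by rewrite -EFinB eqe subr_eq0 => /eqP ->.
have fin := integrable_pos_fin_num measurableT hint.
rewrite (funepos_comp h (fun w => (X w, Y w))) in fin.
rewrite integralE (funepos_comp h (fun w => (X w, Y w))).
rewrite (funeneg_comp h (fun w => (X w, Y w)))/= -pos_neg.
by rewrite subee.
Qed.

End independence.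

(** * Square-integrable random vectors *)

Section integrals.
Context dT (T : measurableType dT) (R : realType) (P : probability T R) (d : nat).
Implicit Types (q : T -> R) (u v : T -> 'rV[R]_d).

Lemma integrable_le_bound q q' : measurable_fun setT q ->
  (forall t, `|q t| <= q' t) -> P.-integrable setT (EFin \o q') ->
  P.-integrable setT (EFin \o q).
Proof.
move=> mq qq'; apply: le_integrable => //; first exact/measurable_EFinP.
by move=> t _ /=; rewrite lee_fin (le_trans (qq' t))// ler_norm.
Qed.

Lemma ge0_integrable_fin q (c : R) : measurable_fun setT q ->
  (forall t, 0 <= q t) -> (\int[P]_t (q t)%:E <= c%:E)%E ->
  P.-integrable setT (EFin \o q).
Proof.
move=> mq q0 qc; apply/integrableP; split; first exact/measurable_EFinP.
rewrite (eq_integral (EFin \o q)) => [|t _]; last by rewrite /= ger0_norm.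
exact: le_lt_trans qc (ltry _).
Qed.

Lemma measurable_dotv u v :
  (forall j, measurable_fun setT (fun t => u t 0 j)) ->
  (forall j, measurable_fun setT (fun t => v t 0 j)) ->
  measurable_fun setT (fun t => dotv (u t) (v t)).
Proof.
by move=> mu mv; apply: measurable_sum => j; exact: measurable_funM.
Qed.

Lemma integrable_dotv u v :
  (forall j, measurable_fun setT (fun t => u t 0 j)) ->
  (forall j, measurable_fun setT (fun t => v t 0 j)) ->
  P.-integrable setT (EFin \o (fun t => enorm (u t) ^+ 2)) ->
  P.-integrable setT (EFin \o (fun t => enorm (v t) ^+ 2)) ->
  P.-integrable setT (EFin \o (fun t => dotv (u t) (v t))).
Proof.
move=> mu mv iu iv.
apply: (@integrable_le_bound _ (fun t => 2^-1 * (enorm (u t) ^+ 2 + enorm (v t) ^+ 2))).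
- exact: measurable_dotv.
- by move=> t; rewrite mulrC norm_dotv_le.
- rewrite (_ : _ \o _ =
    fun t => (2^-1)%:E * ((enorm (u t) ^+ 2)%:E + (enorm (v t) ^+ 2)%:E))%E.
    by apply: integrableZl => //; exact: integrableD.
  by apply/funext => t /=; rewrite -EFinD -EFinM.
Qed.

(** A coordinate is the inner product with a basis vector, which is square-integrable as a constant
    on a probability space. *)
Lemma integrable_coord u j :
  (forall j, measurable_fun setT (fun t => u t 0 j)) ->
  P.-integrable setT (EFin \o (fun t => enorm (u t) ^+ 2)) ->
  P.-integrable setT (fun t => (u t 0 j)%:E).
Proof.
move=> mu iu.
rewrite -[X in integrable _ _ X]/(EFin \o (fun t => u t 0 j)).
rewrite (_ : (fun t => _) = fun t => dotv (u t) (delta_mx 0 j)).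
  apply: integrable_dotv => //.
  exact: (finite_measure_integrable_cst P (enorm (delta_mx 0 j : 'rV[R]_d) ^+ 2)).
apply/funext => t; rewrite /dotv (bigD1 j)//= mxE !eqxx mulr1 big1 ?addr0//.
by move=> k kj; rewrite mxE (negbTE kj) andbF mulr0.
Qed.

Lemma integral_dotv_eq0 u (v : 'rV[R]_d) :
  (forall j, measurable_fun setT (fun t => u t 0 j)) ->
  P.-integrable setT (EFin \o (fun t => enorm (u t) ^+ 2)) ->
  (forall j, \int[P]_t (u t 0 j)%:E = 0)%E ->
  (\int[P]_t (dotv (u t) v)%:E = 0)%E.
Proof.
move=> mu iu u0.
have iuj j := integrable_coord j mu iu.
rewrite (eq_integral (fun t => \sum_(j < d) (v 0 j)%:E * (u t 0 j)%:E)%E); last first.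
  move=> t _; rewrite -sumEFin; apply: eq_bigr => j _.
  by rewrite -EFinM mulrC.
rewrite integral_sum//; last by move=> j; exact: integrableZl.
by rewrite big1// => j _; rewrite integralZl// u0 mule0.
Qed.

Lemma integrable_EFinD q q' : P.-integrable setT (EFin \o q) ->
  P.-integrable setT (EFin \o q') ->
  P.-integrable setT (EFin \o (fun t => q t + q' t)).
Proof. by move=> iq iq'; exact: (integrableD measurableT iq iq'). Qed.

Lemma integrable_EFinZ (c : R) q : P.-integrable setT (EFin \o q) ->
  P.-integrable setT (EFin \o (fun t => c * q t)).
Proof. by move=> iq; exact: (integrableZl measurableT c iq). Qed.

Lemma integrable_EFin_sum (I : finType) (q : I -> T -> R) :
  (forall i, P.-integrable setT (EFin \o q i)) ->
  P.-integrable setT (EFin \o (fun t => \sum_i q i t)).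
Proof.
move=> iq; rewrite (_ : _ \o _ = fun t => \sum_i (q i t)%:E)%E.
  by apply: integrable_sum => // i _; exact: iq.
by apply/funext => t /=; rewrite sumEFin.
Qed.

Lemma Rintegral_sum (I : finType) (q : I -> T -> R) :
  (forall i, P.-integrable setT (EFin \o q i)) ->
  \int[P]_t (\sum_i q i t) = \sum_i \int[P]_t q i t.
Proof.
move=> iq; rewrite /Rintegral.
rewrite (eq_integral (fun t => \sum_i (q i t)%:E)%E) => [|t _]; last by rewrite sumEFin.
rewrite integral_sum//.
rewrite (eq_bigr (fun i => (fine (\int[P]_t (q i t)%:E))%:E)) ?sumEFin// => i _.
by rewrite fineK//; exact: integrable_fin_num (iq i).
Qed.

End integrals.

(** * Continuity with respect to the Euclidean norm *)

Section euclidean_continuity.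
Context (R : realType) (d : nat).

Lemma enorm_continuous : continuous (@enorm R d).
Proof.
have dotvv_continuous : continuous (fun x : 'rV[R]_d => \sum_(j < d) x 0 j ^+ 2).
  apply: continuous_big => [|j _ x]; first exact: add_continuous.
  apply: (@continuous_comp _ _ _ (fun x : 'rV[R]_d => x 0 j) (fun r : R => r ^+ 2)).
    exact: coord_continuous.
  exact: exprn_continuous.
move=> x; apply: (@continuous_comp _ _ _ (fun x : 'rV[R]_d => \sum_(j < d) x 0 j ^+ 2)
  (@Num.sqrt R)); first exact: dotvv_continuous.
exact: sqrt_continuous.
Qed.

Lemma norm_coord_le (x : 'rV[R]_d) j : `|x 0 j| <= enorm x.
Proof.
rewrite -(sqrtr_sqr (x 0 j)) ler_wsqrtr// (bigD1 j)//= lerDl.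
by apply: sumr_ge0 => k _; exact: sqr_ge0.
Qed.

(** The topology comes from the sup norm whereas the Lipschitz bound is Euclidean. Continuity of
    [enorm] makes the bound tend to 0, and each coordinate is dominated by [enorm]. *)
Lemma lipschitz_coord_continuous (g : 'rV[R]_d -> 'rV[R]_d) (L : R) j :
  (forall x y, enorm (g x - g y) <= L * enorm (x - y)) ->
  continuous (fun x => g x 0 j).
Proof.
move=> glip y; apply/(@cvgrPdist_le _ _ _ _ (nbhs_filter y)) => e e0.
have cn : (fun x => L * enorm (y - x)) x @[x --> y] --> L * enorm (y - y).
  have cB : continuous (fun x : 'rV[R]_d => y - x).
    move=> x; apply: (@continuousB R _ _ (cst y) id x).
      exact: cst_continuous.
    by move=> A.
  have cE : continuous (@enorm R d \o (fun x : 'rV[R]_d => y - x)).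
    by move=> x; apply: continuous_comp; [exact: cB|exact: enorm_continuous].
  apply: (@continuousM R _ (cst L) _ y _ (cE y)); exact: cst_continuous.
move/(@cvgrPdist_le _ _ _ _ (nbhs_filter y)) : cn => /(_ _ e0); apply: filterS => x.
rewrite subrr.
have -> : enorm (0 : 'rV[R]_d) = 0.
  by rewrite /enorm big1 ?sqrtr0// => k _; rewrite mxE expr0n.
rewrite mulr0 add0r normrN => h.
apply: le_trans h; apply: le_trans (ler_norm _); apply: le_trans (glip y x).
by have := norm_coord_le (g y - g x) j; rewrite !mxE.
Qed.

End euclidean_continuity.

(** * Expected progress of SGD *)

Section sgd_expectation.
Context (R : realType) (d n b : nat) (dO dX : measure_display).
Context (Omega : measurableType dO) (Xi : measurableType dX).
Context (P : probability Omega R).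
Context (G : Xi -> 'rV[R]_d -> 'rV[R]_d) (xi : nat -> 'I_b -> {RV P >-> Xi}).
Context (f : 'rV[R]_d -> R) (fstar L Delta0 sigma2 : R) (theta0 : 'rV[R]_d).
Context (lr : nat -> R).
Hypothesis L_gt0 : 0 < L.
Hypothesis sigma2_ge0 : 0 <= sigma2.
Hypothesis obj : objective n Delta0 L theta0 fstar f.
Let theta := sgd G xi lr theta0.
Hypothesis orc : oracle G xi sigma2 f theta.

Let noise (x : Xi) (t : 'rV[R]_d) : 'rV[R]_d := G x t - grad f t.

Let measurable_grad j :
  measurable_fun setT (fun t : borel_rV R d => grad f t 0 j).
Proof.
apply: continuous_borel_measurable.
exact: lipschitz_coord_continuous (obj_smooth obj).
Qed.

Let measurable_G dT (T : measurableType dT) (X : T -> Xi) (Y : T -> 'rV[R]_d) j :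
  measurable_fun setT X -> measurable_fun setT (Y : T -> borel_rV R d) ->
  measurable_fun setT (fun t => G (X t) (Y t) 0 j).
Proof.
move=> mX mY.
have mG := measurableT_comp (oracle_measurable orc) (measurable_fun_pair mX mY).
exact: measurableT_comp (measurable_coord j) mG.
Qed.

Let measurable_noise dT (T : measurableType dT) (X : T -> Xi) (Y : T -> 'rV[R]_d) j :
  measurable_fun setT X -> measurable_fun setT (Y : T -> borel_rV R d) ->
  measurable_fun setT (fun t => noise (X t) (Y t) 0 j).
Proof.
move=> mX mY.
rewrite (_ : (fun _ => _) = fun t => G (X t) (Y t) 0 j - grad f (Y t) 0 j).
  apply: measurable_funB; first exact: measurable_G.
  exact: (measurableT_comp (measurable_grad j) mY).
by apply/funext => t; rewrite !mxE.
Qed.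

Lemma measurable_sgd k : measurable_fun setT (theta k : Omega -> borel_rV R d).
Proof.
elim: k => [|k IH]; first exact: measurable_cst.
apply: measurable_fun_coord => j.
rewrite (_ : (fun _ => _) = fun w => theta k w 0 j -
    lr k * (b%:R^-1 * \sum_i G (xi k i w) (theta k w) 0 j)); last first.
  by apply/funext => w; rewrite /theta/= /batch_grad !mxE summxE.
apply: measurable_funB; first exact: (measurableT_comp (measurable_coord j) IH).
apply: measurable_funM; first exact: measurable_cst.
apply: measurable_funM; first exact: measurable_cst.
by apply: measurable_sum => i; exact: measurable_G.
Qed.

Let iterate k : {RV P >-> borel_rV R d} := HB.pack (theta k : Omega -> borel_rV R d)
  (isMeasurableFun.Build _ _ _ _ _ (measurable_sgd k)).

(** The oracle condition on sigma-algebras becomes independence of random variables. [X] stands for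
    any function of the samples of iteration [k]: a single sample or a pair of them. *)
Let sample_iterate k (dT : measure_display) (T : measurableType dT)
    (X : Omega -> T) :
  (forall A, measurable A -> sigma_samples xi k (X @^-1` A)) ->
  independent_pair P X (iterate k).
Proof.
move=> sX A B mA mB; apply: (oracle_independent_past orc); first exact: sX.
apply: sub_sigma_algebra; exists k => //=.
by exists B => //; rewrite setTI.
Qed.

Let sample_sigma k i A : measurable A -> sigma_samples xi k (xi k i @^-1` A).
Proof.
move=> mA; apply: sub_sigma_algebra; exists i => //.
by exists A => //; rewrite setTI.
Qed.

Let sample_iterate1 k i : independent_pair P (xi k i) (iterate k).
Proof. by apply: sample_iterate => A; exact: sample_sigma. Qed.

Let sample2_sigma k i i' A : measurable A ->
  sigma_samples xi k ((fun w => (xi k i w, xi k i' w)) @^-1` A).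
Proof.
(* [Omega'] carries the sigma-algebra generated by the samples of iteration [k], so measurability on
   it means membership in [sigma_samples], and the pairing lemma applies. *)
pose Omega' := g_sigma_algebraType
  (\bigcup_i preimage_set_system setT (xi k i) measurable).
have m1 l : measurable_fun setT (xi k l : Omega' -> Xi).
  by move=> _ B mB; rewrite setTI; exact: sample_sigma.
have m2 := measurable_fun_pair (m1 i) (m1 i').
by move=> mA; have := m2 measurableT A mA; rewrite setTI.
Qed.

Let sample_sample k i i' : i != i' -> independent_pair P (xi k i) (xi k i').
Proof.
move=> ii' A B mA mB.
(* Mutual independence is used for a list of two indices, told apart by their second component. *)
have := oracle_independent orc (J := [:: (k, i); (k, i')])
  (A := fun p => if p.2 == i then A else B).
rewrite !big_cons !big_nil/= !eqxx eq_sym (negbTE ii') setIT mule1; apply.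
  by rewrite /= inE xpair_eqE eqxx (negbTE ii').
by move=> j; case: ifP.
Qed.

Let sample2 k i i' : {RV P >-> (Xi * Xi)%type} := HB.pack (fun w => (xi k i w, xi k i' w))
  (isMeasurableFun.Build _ _ _ _ _
    (measurable_fun_pair (measurable_funPT (xi k i)) (measurable_funPT (xi k i')))).

Let measurable_sqr_noise dT (T : measurableType dT) (X : T -> Xi) (Y : T -> 'rV[R]_d) :
  measurable_fun setT X -> measurable_fun setT (Y : T -> borel_rV R d) ->
  measurable_fun setT (fun t => enorm (noise (X t) (Y t)) ^+ 2).
Proof.
move=> mX mY; under eq_fun do rewrite sqr_enorm.
by apply: measurable_dotv => j; exact: measurable_noise.
Qed.

(** Freezing the iterate by independence, the inner integral is at most [sigma2] almost everywhere,
    and [P] has total mass 1. *)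
Let noise_variance k i :
  (\int[P]_w (enorm (noise (xi k i w) (theta k w)) ^+ 2)%:E <= sigma2%:E)%E.
Proof.
have mh : measurable_fun setT (fun z : (Xi * borel_rV R d)%type =>
    (enorm (noise z.1 z.2) ^+ 2)%:E).
  by apply/measurable_EFinP/measurable_sqr_noise.
rewrite (ge0_integral_independent (sample_iterate1 k i) mh); last first.
  by move=> z; rewrite lee_fin sqr_ge0.
apply: (@le_trans _ _ (\int[P]_w (cst sigma2%:E w))%E); last first.
  by rewrite integral_cst//= probability_setT mule1.
apply: ae_ge0_le_integral => //.
- by move=> w _; apply: integral_ge0 => w' _; rewrite lee_fin sqr_ge0.
- apply: (measurable_integral_sample (xi k i) (iterate k) mh) => z.
  by rewrite lee_fin sqr_ge0.
- by apply: filterS (oracle_variance orc k i) => w; rewrite unlock => h _.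
Qed.


Let integrable_sqr_noise k i :
  P.-integrable setT (EFin \o (fun w => enorm (noise (xi k i w) (theta k w)) ^+ 2)).
Proof.
apply: ge0_integrable_fin (noise_variance k i) => //; last by move=> w; exact: sqr_ge0.
by apply: measurable_sqr_noise => //; exact: measurable_sgd.
Qed.

Let sample_integrable k i : {ae P, forall w, P.-integrable setT
   (EFin \o (fun w' => enorm (noise (xi k i w') (theta k w)) ^+ 2))}.
Proof.
apply: filterS (oracle_variance orc k i) => w; rewrite unlock => vw.
apply: ge0_integrable_fin vw => //; last by move=> w'; exact: sqr_ge0.
by apply: measurable_sqr_noise => //; exact: measurable_cst.
Qed.

(** The quantifier on [v] is inside the almost-everywhere statement: a single null set serves all
    [v], so that [v] may later depend on [w]. *)
Let sample_mean k i : {ae P, forall w, forall v : 'rV[R]_d,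
  (\int[P]_w' (dotv (noise (xi k i w') (theta k w)) v)%:E = 0)%E}.
Proof.
apply: filterS2 (oracle_unbiased orc k i) (sample_integrable k i) => w uw iw v.
apply: integral_dotv_eq0 => // j.
  by apply: measurable_noise => //; exact: measurable_cst.
have := uw j; rewrite unlock.
rewrite (eq_integral (fun w' =>
    ((noise (xi k i w') (theta k w) 0 j)%:E + (grad f (theta k w) 0 j)%:E)%E)); last first.
  by move=> w' _; rewrite -EFinD !mxE subrK.
have mN l : measurable_fun setT (fun w' => noise (xi k i w') (theta k w) 0 l).
  by apply: measurable_noise => //; exact: measurable_cst.
rewrite integralD//; [|exact: (integrable_coord j mN iw)|
  exact: (finite_measure_integrable_cst P (grad f (theta k w) 0 j))].
rewrite integral_cst//= probability_setT mule1.
(* Adding the finite gradient coordinate gives a finite value, so the integral of the noise is a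
   real number and can be cancelled to 0. *)
case: integral => [r| |]//=; rewrite -EFinD => -[] /eqP.
by rewrite -subr_eq0 addrK => /eqP ->.
Qed.



(** Once the iterate is frozen, its gradient is a constant vector, against which the noise has mean
    zero. *)
Let noise_grad k i :
  P.-integrable setT (EFin \o (fun w => enorm (grad f (theta k w)) ^+ 2)) ->
  (\int[P]_w (dotv (noise (xi k i w) (theta k w)) (grad f (theta k w)))%:E = 0)%E.
Proof.
move=> ig.
have mh : measurable_fun setT (fun z : (Xi * borel_rV R d)%type =>
    (dotv (noise z.1 z.2) (grad f z.2))%:E).
  apply/measurable_EFinP/measurable_dotv => j; first exact: measurable_noise.
  by apply: (measurableT_comp (measurable_grad j)).
apply: (integral_independent_eq0 (sample_iterate1 k i) mh).
  apply: integrable_dotv => [j|j||]; last exact: ig.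
  - by apply: measurable_noise => //; exact: measurable_sgd.
  - exact: (measurableT_comp (measurable_grad j) (measurable_sgd k)).
  - exact: integrable_sqr_noise.
by apply: filterS (sample_mean k i) => w mw; exact: (mw (grad f (theta k w))).
Qed.

(** Independence is used twice: first the pair of samples against the iterate, then, at a frozen
    iterate, one sample against the other. *)
Let noise_noise k i i' : i != i' ->
  (\int[P]_w (dotv (noise (xi k i w) (theta k w)) (noise (xi k i' w) (theta k w)))%:E = 0)%E.
Proof.
move=> ii'.
have mh : measurable_fun setT (fun z : ((Xi * Xi) * borel_rV R d)%type =>
    (dotv (noise z.1.1 z.2) (noise z.1.2 z.2))%:E).
  by apply/measurable_EFinP/measurable_dotv => j; apply: measurable_noise => //;
    apply: measurableT_comp.
have ind : independent_pair P (sample2 k i i') (iterate k).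
  by apply: sample_iterate => A; exact: sample2_sigma.
apply: (integral_independent_eq0 ind mh).
  apply: integrable_dotv => [j|j||]; [| |exact: integrable_sqr_noise..].
  - by apply: (@measurable_noise _ _ (xi k i) (theta k)) => //; exact: measurable_sgd.
  - by apply: (@measurable_noise _ _ (xi k i') (theta k)) => //; exact: measurable_sgd.
apply: filterS3 (sample_mean k i) (sample_integrable k i) (sample_integrable k i').
move=> w mw iw iw'.
have mh' : measurable_fun setT (fun z : (Xi * Xi)%type =>
    (dotv (noise z.1 (theta k w)) (noise z.2 (theta k w)))%:E).
  apply/measurable_EFinP/measurable_dotv => j; apply: measurable_noise => //;
    exact: measurable_cst.
change (\int[P]_w' (dotv (noise (xi k i w') (theta k w))
  (noise (xi k i' w') (theta k w)))%:E = 0)%E.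
apply: (integral_independent_eq0 (sample_sample k ii') mh').
  by apply: integrable_dotv => // j; apply: measurable_noise => //; exact: measurable_cst.
(* With the second sample also frozen, its noise is a constant vector [v] for [sample_mean]. *)
by apply: aeW => w'; exact: (mw (noise (xi k i' w') (theta k w))).
Qed.

Hypothesis b_gt0 : (0 < b)%N.

Let mean_noise k w : 'rV[R]_d := b%:R^-1 *: \sum_i noise (xi k i w) (theta k w).

Let batch_gradE k w :
  batch_grad G xi k w (theta k w) = grad f (theta k w) + mean_noise k w.
Proof.
rewrite /mean_noise /batch_grad sumrB sumr_const card_ord scalerBr.
set g := grad f _; have -> : b%:R^-1 *: (g *+ b) = g.
  by rewrite -(scaler_nat b g) scalerA mulVf ?scale1r// pnatr_eq0 -lt0n.
by rewrite addrC subrK.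
Qed.

(** Subtracting [fstar] makes the quantity nonnegative, so that an integrable upper bound suffices
    for its integrability. *)
Definition excess k w := f (theta k w) - fstar.

Definition sqr_gradient k w := enorm (grad f (theta k w)) ^+ 2.

Let excess_ge0 k w : 0 <= excess k w.
Proof. by rewrite subr_ge0 (obj_lower_bound obj). Qed.

Let measurable_excess k : measurable_fun setT (excess k).
Proof.
apply: measurable_funB; last exact: measurable_cst.
apply: (measurableT_comp _ (measurable_sgd k)).
apply: continuous_borel_measurable => t.
exact: differentiable_continuous (obj_differentiable obj t).
Qed.

Let measurable_sqr_gradient k : measurable_fun setT (sqr_gradient k).
Proof.
rewrite /sqr_gradient; under eq_fun do rewrite sqr_enorm.
by apply: measurable_dotv => j;
  exact: (measurableT_comp (measurable_grad j) (measurable_sgd k)).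
Qed.

Lemma integrable_sqr_gradient k : P.-integrable setT (EFin \o excess k) ->
  P.-integrable setT (EFin \o sqr_gradient k).
Proof.
move=> iq; apply: (@integrable_le_bound _ _ _ _ _ (fun w => 2 * L * excess k w)) => //.
  move=> w; rewrite ger0_norm ?sqr_ge0//.
  apply: (sqr_grad_le L_gt0 (obj_differentiable obj) (obj_smooth obj)).
  exact: obj_lower_bound obj.
exact: integrable_EFinZ.
Qed.

Let noise_gradient_integrable k i : P.-integrable setT (EFin \o sqr_gradient k) ->
  P.-integrable setT (EFin \o
    (fun w => dotv (noise (xi k i w) (theta k w)) (grad f (theta k w)))).
Proof.
move=> ig; apply: integrable_dotv => [j|j||]; last exact: ig.
- by apply: measurable_noise => //; exact: measurable_sgd.
- exact: (measurableT_comp (measurable_grad j) (measurable_sgd k)).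
- exact: integrable_sqr_noise.
Qed.

Let mean_noise_gradient k : P.-integrable setT (EFin \o sqr_gradient k) ->
  P.-integrable setT (EFin \o (fun w => dotv (mean_noise k w) (grad f (theta k w)))) /\
  \int[P]_w dotv (mean_noise k w) (grad f (theta k w)) = 0.
Proof.
move=> ig.
have -> : (fun w => dotv (mean_noise k w) (grad f (theta k w))) =
    fun w => b%:R^-1 * \sum_i dotv (noise (xi k i w) (theta k w)) (grad f (theta k w)).
  by apply/funext => w; rewrite dotvZl dotv_suml.
have i1 i := noise_gradient_integrable i ig.
split; first exact/integrable_EFinZ/integrable_EFin_sum.
rewrite RintegralZl//; last exact: integrable_EFin_sum.
rewrite Rintegral_sum// big1 ?mulr0// => i _.
by rewrite /Rintegral noise_grad.
Qed.

Let noise_noise_integrable k i i' : P.-integrable setT (EFin \o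
  (fun w => dotv (noise (xi k i w) (theta k w)) (noise (xi k i' w) (theta k w)))).
Proof.
apply: integrable_dotv => [j|j||]; [| |exact: integrable_sqr_noise..].
- by apply: (@measurable_noise _ _ (xi k i) (theta k)) => //; exact: measurable_sgd.
- by apply: (@measurable_noise _ _ (xi k i') (theta k)) => //; exact: measurable_sgd.
Qed.

(** Of the terms in the expanded square, the off-diagonal ones vanish by [noise_noise]. The [b]
    diagonal ones are at most [sigma2] each, and the factor [1/b^2] leaves [sigma2 / b]. *)
Let mean_noise_variance k :
  P.-integrable setT (EFin \o (fun w => dotv (mean_noise k w) (mean_noise k w))) /\
  \int[P]_w dotv (mean_noise k w) (mean_noise k w) <= sigma2 / b%:R.
Proof.
have -> : (fun w => dotv (mean_noise k w) (mean_noise k w)) =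
    fun w => b%:R^-1 ^+ 2 * \sum_i \sum_i' dotv (noise (xi k i w) (theta k w))
                                               (noise (xi k i' w) (theta k w)).
  apply/funext => w; rewrite dotvZl dotvZr mulrA -expr2 dotv_suml.
  by congr (_ * _); apply: eq_bigr => i _; rewrite dotv_sumr.
have ii i : P.-integrable setT (EFin \o (fun w => \sum_i' dotv (noise (xi k i w) (theta k w))
   (noise (xi k i' w) (theta k w)))).
  exact: integrable_EFin_sum.
split; first exact/integrable_EFinZ/integrable_EFin_sum.
rewrite RintegralZl//; last exact: integrable_EFin_sum.
rewrite Rintegral_sum//.
have -> : sigma2 / b%:R = b%:R^-1 ^+ 2 * \sum_(i < b) sigma2.
  rewrite sumr_const card_ord -mulr_natr; field.
  by rewrite pnatr_eq0 -lt0n.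
rewrite ler_wpM2l ?sqr_ge0//; apply: ler_sum => i _.
rewrite Rintegral_sum// (bigD1 i)//= [X in _ + X]big1 ?addr0; last first.
  by move=> i' ii'; rewrite /Rintegral noise_noise// eq_sym.
rewrite -lee_fin fineK; last exact: integrable_fin_num (noise_noise_integrable k i i).
by under eq_integral do rewrite -sqr_enorm; exact: noise_variance.
Qed.

(** Integrability is propagated together with the inequality: the pointwise descent bound [rhs] is
    integrable and dominates the nonnegative next excess. *)
Lemma sgd_step k : P.-integrable setT (EFin \o excess k) ->
  P.-integrable setT (EFin \o excess k.+1) /\
  \int[P]_w excess k.+1 w <= \int[P]_w excess k w
    - lr k * (1 - L * lr k / 2) * \int[P]_w sqr_gradient k w
    + L * lr k ^+ 2 / 2 * (sigma2 / b%:R).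
Proof.
move=> iq; have ig := integrable_sqr_gradient iq.
have [iU U0] := mean_noise_gradient ig.
have [iV Vle] := mean_noise_variance k.
pose U w := dotv (mean_noise k w) (grad f (theta k w)).
pose V w := dotv (mean_noise k w) (mean_noise k w).
pose c1 := - (lr k * (1 - L * lr k / 2)).
pose c2 := - (lr k - L * lr k ^+ 2).
pose c3 := L * lr k ^+ 2 / 2.
pose rhs w := excess k w + (c1 * sqr_gradient k w + (c2 * U w + c3 * V w)).
have iU' : P.-integrable setT (EFin \o (fun w => c2 * U w)) by exact: integrable_EFinZ.
have iV' : P.-integrable setT (EFin \o (fun w => c3 * V w)) by exact: integrable_EFinZ.
have ig' : P.-integrable setT (EFin \o (fun w => c1 * sqr_gradient k w)).
  exact: integrable_EFinZ.
have i2 := integrable_EFinD iU' iV'.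
have i3 := integrable_EFinD ig' i2.
have irhs : P.-integrable setT (EFin \o rhs) by exact: integrable_EFinD.
have le_rhs w : excess k.+1 w <= rhs w.
  have thetaS : theta k.+1 w = theta k w - lr k *: (grad f (theta k w) + mean_noise k w).
    by rewrite -batch_gradE.
  have := descent_noisy_gradient L_gt0 (obj_differentiable obj) (obj_smooth obj)
    (theta k w) (mean_noise k w) (lr k).
  rewrite /rhs /excess /sqr_gradient /U /V thetaS /c1 /c2 /c3.
  lra.
have iq' : P.-integrable setT (EFin \o excess k.+1).
  apply: (@integrable_le_bound _ _ _ _ _ rhs) => // w.
  by rewrite ger0_norm.
split => //.
apply: (le_trans (le_Rintegral measurableT iq' irhs (fun w _ => le_rhs w))).
rewrite (RintegralD measurableT iq i3) (RintegralD measurableT ig' i2).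
rewrite (RintegralD measurableT iU' iV') !RintegralZl//.
rewrite U0 mulr0 add0r addrA {1}/c1 mulNr lerD2l ler_wpM2l//.
by rewrite divr_ge0// mulr_ge0 ?sqr_ge0// ltW.
Qed.

Lemma integrable_excess k : P.-integrable setT (EFin \o excess k).
Proof.
elim: k => [|k IH]; last by have [] := sgd_step IH.
exact: (finite_measure_integrable_cst P (f theta0 - fstar)).
Qed.

Lemma sgd_telescope K :
  \sum_(k < K) lr k * (1 - L * lr k / 2) * \int[P]_w sqr_gradient k w <=
  Delta0 + \sum_(k < K) L * lr k ^+ 2 / 2 * (sigma2 / b%:R).
Proof.
(* The induction keeps the expected final excess, so that the sum telescopes; this term is discarded
   at the end because it is nonnegative. *)
apply: (@le_trans _ _ (f theta0 - fstar - \int[P]_w excess K w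
   + \sum_(k < K) L * lr k ^+ 2 / 2 * (sigma2 / b%:R))); last first.
  rewrite lerD2r lerBlDr (le_trans (obj_initial_gap obj))// lerDl.
  exact: Rintegral_ge0.
elim: K => [|K IH].
  rewrite !big_ord0 addr0 subr_ge0.
  have /= -> := Rintegral_cst P measurableT (f theta0 - fstar).
  by rewrite probability_setT mulr1.
rewrite !big_ord_recr/=; have [_ h] := sgd_step (integrable_excess K).
move: IH h; set S := \sum_(_ < _) _; set S' := \sum_(_ < _) _; lra.
Qed.

Let expectation_sqr_gradient k :
  ('E_P[sqr_gradient k] = (\int[P]_w sqr_gradient k w)%:E)%E.
Proof.
rewrite unlock fineK//; apply: integrable_fin_num => //.
exact/integrable_sqr_gradient/integrable_excess.
Qed.

(** If every expected squared gradient exceeded [eps^2], the left side of [sgd_telescope] would be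
    strictly larger than the right side, since [1 - L * lr k / 2] is at least
    [1 - L * alpha / 2]. *)
Lemma min_gradient_le (alpha eps : R) (K : nat) : (0 < K)%N -> L * alpha < 2 ->
  (forall k, 0 < lr k <= alpha) ->
  Delta0 + L * sigma2 / (2 * b%:R) * \sum_(k < K) lr k ^+ 2 <=
    (1 - L * alpha / 2) * eps ^+ 2 * \sum_(k < K) lr k ->
  exists k : 'I_K, \int[P]_w sqr_gradient k w <= eps ^+ 2.
Proof.
move=> K0 La lr_bound hK; apply: contrapT => /forallNP no.
have gt_eps (k : 'I_K) : eps ^+ 2 < \int[P]_w sqr_gradient k w.
  by rewrite ltNge; apply/negP; exact: no.
suff : (1 - L * alpha / 2) * eps ^+ 2 * \sum_(k < K) lr k <
    \sum_(k < K) lr k * (1 - L * lr k / 2) * \int[P]_w sqr_gradient k w.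
  apply/negP; rewrite -leNgt; apply: (le_trans (sgd_telescope K)).
  apply: le_trans hK; rewrite lerD2l mulr_sumr; apply: ler_sum => k _.
  rewrite le_eqVlt; apply/orP; left; apply/eqP; field.
  by rewrite pnatr_eq0 -lt0n.
rewrite mulr_sumr; apply: ltr_sum => [|k _].
  by apply/hasP; exists (Ordinal K0); rewrite ?mem_index_enum.
have /andP[lr0 lra] := lr_bound k.
have c0 : 0 < 1 - L * alpha / 2 by lra.
have cle : 1 - L * alpha / 2 <= 1 - L * lr k / 2.
  by have := ler_wpM2l (ltW L_gt0) lra; lra.
rewrite mulrC mulrA; apply: (@le_lt_trans _ _ (lr k * (1 - L * lr k / 2) * eps ^+ 2)).
  by rewrite ler_wpM2r ?sqr_ge0// ler_wpM2l// ltW.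
by rewrite ltr_pM2l// mulr_gt0// (lt_le_trans c0).
Qed.

Lemma iterations_le (p : nat) (alpha eps : R) (K : nat) : p = 1%N \/ p = 2%N ->
  (0 < K)%N -> 0 < eps -> L * alpha < 2 -> (forall k, 0 < lr k <= alpha) ->
  Delta0 + L * sigma2 / (2 * b%:R) * \sum_(k < K) lr k ^+ 2 <=
    (1 - L * alpha / 2) * eps ^+ 2 * \sum_(k < K) lr k ->
  (iterations P p f theta eps <= K%:R%:E)%E.
Proof.
move=> p12 K0 eps0 La lr_bound hK.
have [k gk] := min_gradient_le K0 La lr_bound hK.
apply: ge_ereal_inf; exists K%:R%:E => //; exists K => //=.
apply: (bigmin_inf k) => //.
have g2 : ('E_P[sqr_gradient k] <= (eps ^+ 2)%:E)%E.
  by rewrite expectation_sqr_gradient lee_fin.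
case: p12 => -> //.
rewrite unlock expr1.
(* AM-GM in the form [|g| <= |g|^2 / (2 eps) + eps / 2]: each of the two terms has expectation at
   most [eps / 2]. *)
apply: (@le_trans _ _
    (\int[P]_w ((2 * eps)^-1 * sqr_gradient k w + eps / 2)%:E)%E).
  apply: ge0_le_integral => //.
  - by move=> w _; rewrite lee_fin expr1 enorm_ge0.
  - apply/measurable_EFinP; under eq_fun do rewrite expr1.
    have -> : (fun w => enorm (grad f (theta k w))) = @Num.sqrt R \o sqr_gradient k.
      by apply/funext => w /=; rewrite sqrtr_sqr ger0_norm// enorm_ge0.
    apply: measurableT_comp => //.
    by apply: continuous_measurable_fun; exact: sqrt_continuous.
  - apply/measurable_EFinP/measurable_funD; last exact: measurable_cst.
    by apply: measurable_funM => //; exact: measurable_cst.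
  - move=> w _; rewrite lee_fin expr1 /sqr_gradient; set g := enorm _.
    rewrite -(ler_pM2l (_ : 0 < 2 * eps)); last by rewrite mulr_gt0.
    rewrite mulrDr mulVKf ?gt_eqF ?mulr_gt0//.
    by have := sqr_ge0 (g - eps); nra.
have ig : P.-integrable setT (EFin \o sqr_gradient k).
  exact/integrable_sqr_gradient/integrable_excess.
have ic : P.-integrable setT (EFin \o (fun=> eps / 2)).
  exact: (finite_measure_integrable_cst P (eps / 2)).
have iD := integrable_EFinD (integrable_EFinZ (2 * eps)^-1 ig) ic.
rewrite -[leLHS]fineK; last exact: integrable_fin_num iD.
rewrite lee_fin.
suff : \int[P]_w ((2 * eps)^-1 * sqr_gradient k w + eps / 2) <= eps by [].
rewrite (RintegralD measurableT (integrable_EFinZ (2 * eps)^-1 ig) ic).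
rewrite RintegralZl//.
have /= -> := Rintegral_cst P measurableT (eps / 2).
rewrite probability_setT mulr1.
have : (2 * eps)^-1 * \int[P]_w sqr_gradient k w <= (2 * eps)^-1 * eps ^+ 2.
  by rewrite ler_wpM2l// invr_ge0 mulr_ge0// ltW.
have -> : (2 * eps)^-1 * eps ^+ 2 = eps / 2 by field; rewrite gt_eqF.
lra.
Qed.

End sgd_expectation.

(** * Sums of powers *)

Section power_sums.
Context (R : realType).
Implicit Types (q u s x y : R).

Lemma ln_le_subr1 x : 0 < x -> ln x <= x - 1.
Proof.
by move=> x0; have := @le_ln1Dx R (x - 1); rewrite subrKC; apply; lra.
Qed.

Lemma powR_le_bernoulli u q : 0 <= u -> 0 < q < 1 -> u `^ q <= 1 + q * (u - 1).
Proof.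
rewrite le_eqVlt => /predU1P[<-|u0] /andP[q0 q1].
  by rewrite powR0 ?gt_eqF//; lra.
(* [M] is the weighted mean of [u] and 1. The bound [ln t <= t - 1] at [u / M] and [1 / M], with
   weights [q] and [1 - q], sums to [q ln u <= ln M]. *)
set M := 1 + _; have M0 : 0 < M by rewrite /M; nra.
have MV0 : 0 < M^-1 by rewrite invr_gt0.
have h1 := ln_le_subr1 (mulr_gt0 u0 MV0).
have h2 := ln_le_subr1 MV0.
rewrite lnM ?posrE// lnV ?posrE// in h1; rewrite lnV ?posrE// in h2.
have e : q * (u * M^-1 - 1) + (1 - q) * (M^-1 - 1) = 0.
  by rewrite /M; field; rewrite -/M; lra.
have : q * ln u <= ln M by nra.
rewrite /powR gt_eqF// => h; rewrite -[leRHS]lnK ?posrE//.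
by rewrite ler_expR.
Qed.

Lemma powRN_ge_bernoulli u q : 0 < u -> 0 < q -> 1 + q * (1 - u) <= u `^ (- q).
Proof.
move=> u0 q0; rewrite /powR gt_eqF//.
apply: le_trans (expR_ge1Dx _).
have := ln_le_subr1 u0; nra.
Qed.

Lemma powR_ratio (m n : nat) q : m.+1%:R `^ q * (n%:R / m.+1%:R) `^ q = n%:R `^ q :> R.
Proof. by rewrite -powRM// ?divr_ge0// mulrC divfK// pnatr_eq0. Qed.

Lemma natr_divS (m : nat) : m%:R / m.+1%:R = 1 - m.+1%:R^-1 :> R.
Proof. by rewrite -[in LHS](addrK 1 m%:R) natr1 mulrBl divff ?pnatr_eq0// mul1r. Qed.

Lemma powR_addr1 x q : 0 < x -> x `^ (q + 1) * x^-1 = x `^ q.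
Proof.
move=> x0; rewrite -(powR_inv1 (ltW x0)) -powRD ?addrK//.
by rewrite (gt_eqF x0) implybT.
Qed.

(** This is the comparison with an integral, by induction. After division by [(K+1)^(1-s)], the step
    is the Bernoulli inequality at [u = K / (K+1)], where [u - 1 = - 1 / (K+1)]; the value [u = 0]
    occurs at the first step. *)
Lemma sum_powR_le s (K : nat) : 0 < s < 1 ->
  \sum_(k < K) k.+1%:R `^ (- s) <= (1 - s)^-1 * K%:R `^ (1 - s).
Proof.
move=> /andP[s0 s1]; elim: K => [|K IH].
  by rewrite big_ord0 mulr_ge0 ?powR_ge0// invr_ge0; lra.
rewrite big_ord_recr/=.
have q0 : 0 < 1 - s by lra.
apply: (le_trans (lerD IH (lexx _))).
rewrite -(ler_pM2l q0) mulrDr !mulrA divff ?gt_eqF// !mul1r.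
have N0 : 0 < K.+1%:R :> R by rewrite ltr0n.
have -> : K.+1%:R `^ (- s) = K.+1%:R `^ (1 - s) * K.+1%:R^-1 :> R.
  by rewrite -(powR_addr1 (- s) N0) (addrC (- s)).
rewrite -(powR_ratio K K) mulrCA -mulrDr.
rewrite -[leRHS]mulr1 ler_wpM2l ?powR_ge0//.
have := @powR_le_bernoulli (K%:R / K.+1%:R) (1 - s) _ _.
rewrite [X in _ * (X - 1)]natr_divS addrAC subrr add0r.
rewrite divr_ge0// => /(_ isT) h.
have q01 : 0 < 1 - s < 1 by apply/andP; split; lra.
move: (h q01); set r := (_ / _) `^ _; set v := _^-1; lra.
Qed.

Lemma sum_powR_le_cst s (K : nat) : 1 < s ->
  \sum_(k < K) k.+1%:R `^ (- s) <= s / (s - 1) :> R.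
Proof.
move=> s1; have q0 : 0 < s - 1 by lra.
case: K => [|K]; first by rewrite big_ord0 divr_ge0//; lra.
(* The intermediate bound is 1 plus the integral of [x^(-s)] from 1 to [K+1]; unlike the constant,
   it is strong enough for the induction. *)
apply: (@le_trans _ _ ((s - K.+1%:R `^ (- (s - 1))) / (s - 1))); last first.
  by rewrite ler_pM2r ?invr_gt0// gerBl powR_ge0.
elim: K => [|K IH]; first by rewrite big_ord1 !powR1 divff ?gt_eqF.
rewrite big_ord_recr/=; apply: (le_trans (lerD IH (lexx _))).
rewrite -(ler_pM2r q0) mulrDl !divfK ?gt_eqF//.
have N0 : 0 < K.+2%:R :> R by rewrite ltr0n.
have -> : K.+2%:R `^ (- s) = K.+2%:R `^ (- (s - 1)) * K.+2%:R^-1 :> R.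
  by rewrite -(powR_addr1 (- s) N0) opprB addrC.
rewrite -(powR_ratio K.+1 K.+1).
set p := K.+2%:R `^ _; have p0 : 0 <= p by exact: powR_ge0.
have := @powRN_ge_bernoulli (K.+1%:R / K.+2%:R) (s - 1) _ q0.
rewrite [X in _ * (1 - X)]natr_divS subKr.
rewrite divr_gt0// => /(_ isT); set r := (_ / _) `^ _; set v := _^-1 => h.
nra.
Qed.

End power_sums.

(** * Step sizes and number of iterations *)

Section step_sizes.
Context (R : realType).
Implicit Types (x y a r s eps alpha T : R) (k K : nat).

Lemma powRN_antitone x y r : 0 < x -> x <= y -> 0 <= r -> y `^ (- r) <= x `^ (- r).
Proof.
move=> x0 xy r0; have y0 := lt_le_trans x0 xy.
rewrite !powRN lef_pV2 ?posrE ?powR_gt0//.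
by apply: ge0_ler_powR => //; rewrite nnegrE ltW.
Qed.

(** With [F] the floor, the first bound is the sum of [k/T < F + 1] and [1/T <= 1 <= F + 1]. *)
Lemma decay_base_bounds T k : 1 <= T ->
  k.+1%:R * (2 * T)^-1 <= (Num.floor (k%:R / T))%:~R + 1 :> R /\
  1 <= (Num.floor (k%:R / T))%:~R + 1 :> R /\
  (Num.floor (k%:R / T))%:~R + 1 <= k.+1%:R :> R.
Proof.
move=> T1; have T0 : 0 < T by lra.
have f0 : 0 <= (Num.floor (k%:R / T))%:~R :> R.
  by rewrite ler0z floor_ge0 divr_ge0// ltW.
have fle : (Num.floor (k%:R / T))%:~R <= k%:R / T :> R by exact: floor_le.
have flt : k%:R / T < (Num.floor (k%:R / T))%:~R + 1 :> R.
  by have := lt_succ_floor (k%:R / T); rewrite intrD1.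
have kT : k%:R / T <= k%:R :> R by rewrite ler_pdivrMr// ler_peMr.
split; last by rewrite -natr1; split; lra.
have TV : T^-1 <= 1 :> R by rewrite invf_le1.
rewrite invfM -natr1 mulrCA mulrDl mul1r.
set F := _%:~R in f0 flt *; lra.
Qed.

Lemma decay_rateE alpha T a k : decay_rate alpha T a k =
  alpha * ((Num.floor (k%:R / T))%:~R + 1) `^ (- a).
Proof. by rewrite powRN. Qed.

Lemma decay_rate_bound alpha T a k : 0 < alpha -> 1 <= T -> 0 <= a ->
  0 < decay_rate alpha T a k <= alpha.
Proof.
move=> al0 T1 a0; have [_ [b1 _]] := decay_base_bounds k T1.
have b0 := lt_le_trans ltr01 b1.
rewrite decay_rateE mulr_gt0 ?powR_gt0//=.
by rewrite ger_pMr//; have := powRN_antitone ltr01 b1 a0; rewrite powR1.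
Qed.

(** Each of the [K] steps is at least [alpha * K^(-a)], because the base of the power is at most
    [k + 1 <= K]. *)
Lemma sum_decay_rate_ge alpha T a K : 0 < alpha -> 1 <= T -> 0 <= a -> (0 < K)%N ->
  alpha * K%:R `^ (1 - a) <= \sum_(k < K) decay_rate alpha T a k.
Proof.
move=> al0 T1 a0 K0.
have K0' : 0 < K%:R :> R by rewrite ltr0n.
have -> : alpha * K%:R `^ (1 - a) = \sum_(k < K) alpha * K%:R `^ (- a).
  rewrite sumr_const card_ord -mulrnAr; congr (_ * _).
  rewrite powRD ?(gt_eqF K0') ?implybT// powRr1 ?ltW// mulr_natl.
  by [].
apply: ler_sum => k _; rewrite decay_rateE ler_pM2l//.
have [_ [b1 bk]] := decay_base_bounds k T1.
apply: powRN_antitone => //; first exact: lt_le_trans b1.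
by rewrite (le_trans bk)// ler_nat.
Qed.

Lemma sqr_decay_rate_le alpha T a k : 0 < alpha -> 1 <= T -> 0 <= a ->
  decay_rate alpha T a k ^+ 2 <=
  alpha ^+ 2 * (2 * T)^-1 `^ (- (2 * a)) * k.+1%:R `^ (- (2 * a)).
Proof.
move=> al0 T1 a0; have [bT [b1 _]] := decay_base_bounds k T1.
have T2 : 0 < (2 * T)^-1 by rewrite invr_gt0; lra.
rewrite decay_rateE exprMn -mulrA ler_pM2l ?exprn_gt0// [leRHS]mulrC.
rewrite -[leRHS]powRM ?ler0n ?(ltW T2)//.
set x := _ + 1 in b1 bT *.
have x0 : 0 < x by exact: lt_le_trans b1.
have -> : (x `^ (- a)) ^+ 2 = x `^ (- (2 * a)).
  rewrite expr2 -powRD ?(gt_eqF x0) ?implybT//; congr (_ `^ _); lra.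
by apply: powRN_antitone => //; [rewrite mulr_gt0|rewrite mulr_ge0].
Qed.

(** An exponent [s] below [2 * a] weakens the bound, but for [a = 1/2] it avoids the harmonic
    sum. *)
Lemma sum_sqr_decay_rate_le alpha T a K s : 0 < alpha -> 1 <= T -> 0 <= a ->
  0 <= s <= 2 * a ->
  \sum_(k < K) decay_rate alpha T a k ^+ 2 <=
  alpha ^+ 2 * (2 * T)^-1 `^ (- (2 * a)) * \sum_(k < K) k.+1%:R `^ (- s).
Proof.
move=> al0 T1 a0 /andP[s0 sa]; rewrite mulr_sumr; apply: ler_sum => k _.
apply: (le_trans (sqr_decay_rate_le k al0 T1 a0)).
rewrite ler_wpM2l ?mulr_ge0 ?powR_ge0 ?(ltW al0)//.
by apply: ler_powR; [rewrite ler1n|lra].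
Qed.

End step_sizes.

(** * Number of iterations sufficient for each schedule *)

Section iteration_count.
Context (R : realType) (L Delta0 sigma2 alpha eps0 gap : R).
Hypotheses (L_gt0 : 0 < L) (Delta0_gt0 : 0 < Delta0) (sigma2_ge0 : 0 <= sigma2).
Hypotheses (alpha_gt0 : 0 < alpha) (alpha_lt : L * alpha < 2) (eps0_gt0 : 0 < eps0).

Definition enough_iterations (lr : nat -> R) (b : nat) (eps : R) (K : nat) :=
  Delta0 + L * sigma2 / (2 * b%:R) * \sum_(k < K) lr k ^+ 2 <=
    (1 - L * alpha / 2) * eps ^+ 2 * \sum_(k < K) lr k.

Let m := 1 - L * alpha / 2.

Let m_gt0 : 0 < m.
Proof. by rewrite /m subr_gt0 ltr_pdivrMr// mul1r. Qed.

Lemma batch_size_ge s eps :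
  bstar s alpha L sigma2 gap eps <= (batch_size s alpha L sigma2 gap eps)%:R.
Proof.
rewrite /batch_size; set x := bstar _ _ _ _ _ _.
apply: (le_trans (ceil_ge x)); apply: (@le_trans _ _ `|Num.ceil x|%N%:R).
  by rewrite -[leRHS]/((`|Num.ceil x|%N : int)%:~R) ler_int lez_abs.
by rewrite ler_nat leq_maxr.
Qed.

(** Rounding up adds less than 1, and the maximum with 1 adds at most 1 more. *)
Lemma batch_size_le s eps : 0 <= bstar s alpha L sigma2 gap eps ->
  (batch_size s alpha L sigma2 gap eps)%:R <= bstar s alpha L sigma2 gap eps + 2.
Proof.
rewrite /batch_size; set x := bstar _ _ _ _ _ _ => x0.
have c0 : 0 <= Num.ceil x by rewrite -(ler_int R) (le_trans x0)// ceil_ge.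
have h : `|Num.ceil x|%N%:R < x + 1.
  rewrite -[ltLHS]/((`|Num.ceil x|%N : int)%:~R) gez0_abs//.
  by have := ceilB1_lt x; rewrite intrB ltrBlDr.
have : (maxn 1 `|Num.ceil x|)%:R <= 1 + `|Num.ceil x|%N%:R :> R.
  by rewrite nat1r ler_nat geq_max leqnSn.
lra.
Qed.

Lemma batch_size_gt0 s eps : (0 < batch_size s alpha L sigma2 gap eps)%N.
Proof. by rewrite /batch_size leq_max. Qed.

Lemma K_order_gt0 (s : schedule R) eps : 0 < eps -> 0 < K_order s eps.
Proof. by move=> e0; case: s => *; rewrite invr_gt0 ?exprn_gt0 ?powR_gt0. Qed.

Lemma K_order_le (s : schedule R) eps : schedule_ok s -> 0 < eps <= eps0 ->
  K_order s eps0 <= K_order s eps.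
Proof.
move=> ok /andP[e0 ee0]; case: s ok => [_|T a [_ /andP[a0 a1]]|T _|T a [_ /andP[a0 a1]]];
  rewrite lef_pV2 ?posrE ?exprn_gt0 ?powR_gt0//.
- by rewrite ler_sqr ?nnegrE ?(ltW e0) ?(ltW eps0_gt0).
- by apply: ge0_ler_powR; rewrite ?nnegrE ?(ltW e0) ?(ltW eps0_gt0)// divr_ge0// ltW.
- by rewrite lerXn2r ?nnegrE ?(ltW e0) ?(ltW eps0_gt0).
- apply: ge0_ler_powR; rewrite ?nnegrE ?(ltW e0) ?(ltW eps0_gt0)//.
  by rewrite divr_ge0// subr_ge0 ltW.
Qed.

Lemma constant_enough eps K b : 0 < eps -> (0 < b)%N ->
  2 * C2 alpha L sigma2 / eps ^+ 2 <= b%:R ->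
  2 * Delta0 / (alpha * m) * (eps ^+ 2)^-1 <= K%:R ->
  enough_iterations (fun=> alpha) b eps K.
Proof.
move=> e0 b0; have m0 := m_gt0; have b0' : 0 < b%:R :> R by rewrite ltr0n.
have e20 : 0 < eps ^+ 2 by rewrite exprn_gt0.
have c0 : 0 < 2 - L * alpha by rewrite subr_gt0.
rewrite /C2 ler_pdivrMr// mulrA ler_pdivrMr// => hb.
rewrite ler_pdivrMr// ler_pdivrMr ?mulr_gt0// => hK.
rewrite /enough_iterations -/m !sumr_const card_ord
  -(mulr_natr alpha) -(mulr_natr (alpha ^+ 2)).
have K0 : 0 <= K%:R :> R by [].
(* The batch size makes the noise at most half of the right-hand side; the bound on [K] does the
   same for [Delta0]. *)
have noise : L * sigma2 / (2 * b%:R) * (alpha ^+ 2 * K%:R) <=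
    m * eps ^+ 2 * (alpha * K%:R) / 2.
  rewrite mulrAC ler_pdivrMr ?mulr_gt0//.
  have := ler_wpM2r (mulr_ge0 (ltW alpha_gt0) K0) hb.
  rewrite /m; nra.
nra.
Qed.

(* As [K >= 1], the initial gap and the noise are both at most a multiple of
   [K^r], so it only remains to balance [K^r] against [eps^2 K^(r+e)]. *)
Lemma decay_enough (lr : nat -> R) (B r e eps : R) K b :
  0 < eps -> (0 < b)%N -> (0 < K)%N -> 0 <= r -> 0 < e -> 0 <= B ->
  alpha * K%:R `^ (r + e) <= \sum_(k < K) lr k ->
  \sum_(k < K) lr k ^+ 2 <= B * K%:R `^ r ->
  ((Delta0 + L * sigma2 * B / 2) / (m * alpha)) `^ e^-1 * (eps `^ (2 / e))^-1 <= K%:R ->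
  enough_iterations lr b eps K.
Proof.
move=> e0 b0 K0 r0 re0 B0 S1 S2 hK.
have K1 : 1 <= K%:R :> R by rewrite ler1n.
have KP : 0 < K%:R :> R by rewrite ltr0n.
have b1 : 1 <= b%:R :> R by rewrite ler1n.
have m0 := m_gt0.
have e20 : 0 < eps ^+ 2 by rewrite exprn_gt0.
have ma0 : 0 < m * alpha by rewrite mulr_gt0.
set M := (Delta0 + L * sigma2 * B / 2) / (m * alpha) in hK.
have Ls0 : 0 <= L * sigma2 by rewrite mulr_ge0// ltW.
have M0 : 0 <= M.
  apply: divr_ge0; last exact: ltW.
  by apply: addr_ge0; [exact: ltW|rewrite divr_ge0// mulr_ge0].
have ME : Delta0 + L * sigma2 * B / 2 = M * (m * alpha).
  by rewrite /M divfK// gt_eqF.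
(* Raising the lower bound on [K] to the power [e] undoes both exponents. *)
have hKe : M <= eps ^+ 2 * K%:R `^ e.
  have : (M `^ e^-1 * (eps `^ (2 / e))^-1) `^ e <= K%:R `^ e.
    apply: ge0_ler_powR => //; rewrite ?nnegrE ?ler0n ?(ltW re0)//.
    by rewrite mulr_ge0 ?invr_ge0 ?powR_ge0.
  rewrite -powRN powRM ?powR_ge0// -!powRrM mulVf ?gt_eqF// powRr1//.
  rewrite mulNr divfK ?gt_eqF// powRN powR_mulrn ?(ltW e0)//.
  by rewrite ler_pdivrMr// mulrC.
have Kr1 : 1 <= K%:R `^ r by have := ler_powR K1 r0; rewrite powRr0.
rewrite /enough_iterations; apply: (@le_trans _ _ (M * (m * alpha) * K%:R `^ r)).
  rewrite -ME (mulrDl Delta0) lerD//; first by rewrite ler_peMr// ltW.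
  have -> : L * sigma2 * B / 2 * K%:R `^ r = L * sigma2 / 2 * (B * K%:R `^ r) by field.
  apply: ler_pM => //.
  - by rewrite divr_ge0// mulr_ge0.
  - by apply: sumr_ge0 => k _; exact: sqr_ge0.
  - rewrite ler_wpM2l// lef_pV2 ?posrE ?mulr_gt0 ?(lt_le_trans ltr01 b1)//.
    by rewrite ler_peMr.
rewrite -/m; apply: (@le_trans _ _ (m * eps ^+ 2 * (alpha * K%:R `^ (r + e)))); last first.
  by rewrite ler_pM2l ?mulr_gt0.
rewrite powRD ?(gt_eqF KP) ?implybT//.
have := ler_wpM2r (mulr_ge0 (ltW ma0) (le_trans ler01 Kr1)) hKe.
lra.
Qed.

(** A batch of at least [1/eps^2] samples reduces the noise to order [eps^2 K^(1/4)], against a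
    right-hand side of order [eps^2 K^(1/2)]. In terms of [k4 = K^(1/4)] all the inequalities are
    polynomial. *)
Lemma decay_half_enough (lr : nat -> R) (B eps : R) K b :
  0 < eps <= eps0 -> (0 < b)%N -> (0 < K)%N -> 0 <= B -> (eps ^+ 2)^-1 <= b%:R ->
  alpha * K%:R `^ 2^-1 <= \sum_(k < K) lr k ->
  \sum_(k < K) lr k ^+ 2 <= B * K%:R `^ 4^-1 ->
  ((2 * Delta0 / (m * alpha)) ^+ 2 +
    (L * sigma2 * B / (m * alpha)) ^+ 4 * eps0 ^+ 4) * (eps ^+ 4)^-1 <= K%:R ->
  enough_iterations lr b eps K.
Proof.
move=> /andP[e0 ee0] b0 K0 B0 hb S1 S2 hK.
have KP : 0 < K%:R :> R by rewrite ltr0n.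
have m0 := m_gt0.
have ma0 : 0 < m * alpha by rewrite mulr_gt0.
have Ls0 : 0 <= L * sigma2 by rewrite mulr_ge0// ltW.
have e20 : 0 < eps ^+ 2 by rewrite exprn_gt0.
have e40 : 0 < eps ^+ 4 by rewrite exprn_gt0.
set k4 := K%:R `^ 4^-1 in S2.
have k40 : 0 < k4 by rewrite powR_gt0.
have k42 : K%:R `^ 2^-1 = k4 ^+ 2 :> R.
  by rewrite -powR_mulrn ?(ltW k40)// /k4 -powRrM; congr (_ `^ _); field.
have k44 : K%:R = k4 ^+ 4 :> R.
  by rewrite -powR_mulrn ?(ltW k40)// /k4 -powRrM mulVf// powRr1// ltW.
rewrite k42 in S1; rewrite ler_pdivrMr// k44 in hK.
set N1 := 2 * Delta0 / (m * alpha) in hK.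
set N2 := L * sigma2 * B / (m * alpha) in hK.
have N1E : 2 * Delta0 = N1 * (m * alpha) by rewrite divfK// gt_eqF.
have N2E : L * sigma2 * B = N2 * (m * alpha) by rewrite divfK// gt_eqF.
have N10 : 0 <= N1 by rewrite divr_ge0 ?mulr_ge0// ltW.
have N20 : 0 <= N2 by rewrite divr_ge0 ?(ltW ma0)// mulr_ge0.
have P2 : 0 <= N2 ^+ 4 * eps0 ^+ 4 by rewrite mulr_ge0 ?exprn_ge0// ltW.
(* The first summand of the constant handles the initial gap. The second handles the noise, its
   factor [eps0^4] compensating [eps^4]. *)
have h1 : N1 <= k4 ^+ 2 * eps ^+ 2.
  have : N1 ^+ 2 <= (k4 ^+ 2 * eps ^+ 2) ^+ 2.
    have -> : (k4 ^+ 2 * eps ^+ 2) ^+ 2 = k4 ^+ 4 * eps ^+ 4 by ring.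
    by apply: le_trans hK; rewrite lerDl.
  rewrite ler_sqr// nnegrE mulr_ge0//; exact: sqr_ge0.
have h2 : N2 <= k4.
  rewrite -(@ler_pXn2r _ 4) ?nnegrE ?(ltW k40)//.
  rewrite -(ler_pM2r e40); apply: le_trans hK.
  apply: (@le_trans _ _ (N2 ^+ 4 * eps0 ^+ 4)); last by rewrite lerDr sqr_ge0.
  by rewrite ler_wpM2l ?exprn_ge0// lerXn2r ?nnegrE ?(ltW e0) ?(ltW eps0_gt0).
have bV : b%:R^-1 <= eps ^+ 2 by rewrite -[leRHS]invrK lef_pV2 ?posrE ?invr_gt0 ?ltr0n.
rewrite /enough_iterations -/m.
apply: (@le_trans _ _ (m * eps ^+ 2 * (alpha * k4 ^+ 2))); last first.
  by rewrite ler_pM2l ?mulr_gt0.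
have noise : L * sigma2 / (2 * b%:R) * \sum_(k < K) lr k ^+ 2 <=
    L * sigma2 * eps ^+ 2 / 2 * (B * k4).
  apply: ler_pM => //.
  - by rewrite divr_ge0// mulr_ge0.
  - by apply: sumr_ge0 => k _; exact: sqr_ge0.
  - by rewrite invfM mulrA [leRHS]mulrAC ler_wpM2l// divr_ge0.
have h3 : N2 * k4 <= k4 ^+ 2 by rewrite expr2 ler_pM2r.
(* Half of the right-hand side absorbs [Delta0], the other half the noise. *)
have -> : m * eps ^+ 2 * (alpha * k4 ^+ 2) =
  m * alpha * (k4 ^+ 2 * eps ^+ 2) / 2 + eps ^+ 2 / 2 * (m * alpha) * k4 ^+ 2 by field.
apply: lerD; first by rewrite ler_pdivlMr// mulrC N1E mulrC ler_pM2l.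
apply: (le_trans noise).
have -> : L * sigma2 * eps ^+ 2 / 2 * (B * k4) = eps ^+ 2 / 2 * (m * alpha) * (N2 * k4).
  transitivity (eps ^+ 2 / 2 * k4 * (L * sigma2 * B)); first by field.
  by rewrite N2E; field.
by rewrite ler_pM2l// mulr_gt0// divr_gt0.
Qed.

End iteration_count.

(** * Orders of the complexities *)

Lemma learning_rate_bound (R : realType) (s : schedule R) (alpha : R) k :
  0 < alpha -> schedule_ok s -> 0 < learning_rate s alpha k <= alpha.
Proof.
move=> al0; case: s => [_|T a [T1 /andP[a0 _]]|T T1|T a [T1 /andP[a0 _]]] /=.
- by rewrite al0 lexx.
- by apply: decay_rate_bound => //; exact: ltW.
- by apply: decay_rate_bound => //; rewrite invr_ge0.
- by apply: decay_rate_bound => //; lra.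
Qed.

Lemma schedule_enough (R : realType) (L Delta0 sigma2 alpha eps0 gap : R)
    (s : schedule R) : 0 < L -> 0 < Delta0 -> 0 <= sigma2 ->
  0 < alpha -> L * alpha < 2 -> 0 < eps0 -> schedule_ok s ->
  exists2 c : R, 0 <= c & forall eps K, 0 < eps <= eps0 -> (0 < K)%N ->
    c * K_order s eps <= K%:R ->
    enough_iterations L Delta0 sigma2 alpha (learning_rate s alpha)
      (batch_size s alpha L sigma2 gap eps) eps K.
Proof.
move=> L0 D0 s20 al0 al2 eps00 ok.
have m0 : 0 < 1 - L * alpha / 2 by rewrite subr_gt0 ltr_pdivrMr// mul1r.
have ma0 : 0 < (1 - L * alpha / 2) * alpha by rewrite mulr_gt0.
case: s ok => [_|T a [T1 /andP[a0 a1]]|T T1|T a [T1 /andP[a0 a1]]].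
- exists (2 * Delta0 / (alpha * (1 - L * alpha / 2))).
    by rewrite divr_ge0 ?mulr_ge0 ?(ltW D0) ?(ltW al0) ?(ltW m0).
  move=> eps K /andP[e0 _] K0 hK; apply: constant_enough => //.
    exact: batch_size_gt0.
  exact: (batch_size_ge L sigma2 alpha gap Constant).
(* The exponents in [decay_enough] are [r = 1 - 2 a] and [e = a], whence the order [eps^(-2/a)]. *)
- pose B := alpha ^+ 2 * (2 * T)^-1 `^ (- (2 * a)) / (1 - 2 * a).
  have q0 : 0 < 1 - 2 * a by lra.
  have B0 : 0 <= B by rewrite divr_ge0 ?(ltW q0)// mulr_ge0 ?powR_ge0 ?sqr_ge0.
  have S1 K : (0 < K)%N -> alpha * K%:R `^ (1 - 2 * a + a) <=
      \sum_(k < K) decay_rate alpha T a k.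
    rewrite (_ : 1 - 2 * a + a = 1 - a); last by ring.
    by apply: sum_decay_rate_ge => //; exact: ltW.
  have S2 K : \sum_(k < K) decay_rate alpha T a k ^+ 2 <= B * K%:R `^ (1 - 2 * a).
    have a20 : 0 <= 2 * a <= 2 * a by rewrite lexx andbT; lra.
    apply: (le_trans (sum_sqr_decay_rate_le K al0 T1 (ltW a0) a20)).
    rewrite /B -[leRHS]mulrA ler_wpM2l ?mulr_ge0 ?powR_ge0 ?(ltW al0)//.
    by apply: sum_powR_le; apply/andP; split; lra.
  (* The constant is found by unification with the requirement of [decay_enough] on [K]; its sign is
     checked last. *)
  eexists; last first.
    move=> eps K /andP[e0 _] K0 hK.
    apply: (decay_enough L0 D0 s20 al0 al2 _ _ _ _ a0 B0 (S1 K K0) (S2 K)) => //.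
    + exact: batch_size_gt0.
    + exact: ltW.
    + exact: hK.
  exact: powR_ge0.
- pose B := alpha ^+ 2 * (2 * T)^-1 `^ (- (2 * 2^-1)) * 4.
  have B0 : 0 <= B by rewrite !mulr_ge0 ?powR_ge0 ?(ltW al0).
  have h0 : 0 <= 2^-1 :> R by rewrite invr_ge0.
  have S1 K : (0 < K)%N -> alpha * K%:R `^ 2^-1 <=
      \sum_(k < K) decay_rate alpha T 2^-1 k.
    move=> K0; have := sum_decay_rate_ge al0 T1 h0 K0.
    by rewrite (_ : 1 - 2^-1 = 2^-1 :> R); last by field.
  have S2 K : \sum_(k < K) decay_rate alpha T 2^-1 k ^+ 2 <= B * K%:R `^ 4^-1.
    (* The exponent 3/4 lies below [2 a = 1]; the sum is then at most [4 K^(1/4)], which explains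
       the factor 4 in [B]. *)
    have s34 : 0 <= (3 / 4 : R) <= 2 * 2^-1 by apply/andP; split; lra.
    have s34' : 0 < (3 / 4 : R) < 1 by apply/andP; split; lra.
    apply: (le_trans (sum_sqr_decay_rate_le K al0 T1 h0 s34)).
    rewrite /B -[leRHS]mulrA ler_wpM2l ?mulr_ge0 ?powR_ge0 ?(ltW al0)//.
    have := sum_powR_le K s34'.
    by rewrite (_ : 1 - 3 / 4 = 4^-1 :> R) ?invrK//; field.
  have D20 : 0 <= D2 alpha L sigma2 T.
    rewrite divr_ge0 ?subr_ge0 ?(ltW al2)// !mulr_ge0 ?(ltW L0) ?(ltW al0)//.
    exact: le_trans T1.
  have hb eps : 0 < eps ->
      (eps ^+ 2)^-1 <= (batch_size (Decay2 T) alpha L sigma2 gap eps)%:R.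
    move=> e0; apply: le_trans (batch_size_ge _ _ _ _ _ _) => /=.
    by rewrite ler_pdivlMr ?exprn_gt0// mulVf ?gt_eqF ?exprn_gt0// lerDr.
  eexists; last first.
    move=> eps K ebound K0 hK; have /andP[e0 _] := ebound.
    apply: (decay_half_enough L0 D0 s20 al0 al2 eps00 ebound _ K0 B0 (hb eps e0)
      (S1 K K0) (S2 K)); last exact: hK.
    exact: batch_size_gt0.
  apply: addr_ge0; first exact: sqr_ge0.
  by apply: mulr_ge0; apply: exprn_even_ge0.
(* Here the squared steps are summable, so [decay_enough] is used with [r = 0] and [e = 1 - a]. *)
- pose B := alpha ^+ 2 * (2 * T)^-1 `^ (- (2 * a)) * (2 * a / (2 * a - 1)).
  have B0 : 0 <= B.
    by rewrite !mulr_ge0 ?powR_ge0 ?(ltW al0) ?invr_ge0//; lra.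
  have S1 K : (0 < K)%N -> alpha * K%:R `^ (0 + (1 - a)) <=
      \sum_(k < K) decay_rate alpha T a k.
    by rewrite add0r; apply: sum_decay_rate_ge => //; lra.
  have S2 K : \sum_(k < K) decay_rate alpha T a k ^+ 2 <= B * K%:R `^ 0.
    have a20 : 0 <= 2 * a <= 2 * a by rewrite lexx andbT; lra.
    have a0' : 0 <= a by lra.
    rewrite powRr0 mulr1; apply: (le_trans (sum_sqr_decay_rate_le K al0 T1 a0' a20)).
    rewrite /B ler_wpM2l ?mulr_ge0 ?powR_ge0 ?(ltW al0)//.
    by apply: sum_powR_le_cst; lra.
  have a1' : 0 < 1 - a by rewrite subr_gt0.
  eexists; last first.
    move=> eps K /andP[e0 _] K0 hK.
    apply: (decay_enough L0 D0 s20 al0 al2 _ _ _ _ a1' B0 (S1 K K0) (S2 K)) => //.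
    + exact: batch_size_gt0.
    + exact: hK.
  exact: powR_ge0.
Qed.

Lemma complexity_le (R : realType) (d n b : nat) (L Delta0 sigma2 alpha : R)
    (theta0 : 'rV[R]_d) (lr : nat -> R) (eps : R) (K p : nat) :
  0 < L -> 0 <= sigma2 -> L * alpha < 2 -> (0 < b)%N -> (0 < K)%N -> 0 < eps ->
  p = 1%N \/ p = 2%N -> (forall k, 0 < lr k <= alpha) ->
  enough_iterations L Delta0 sigma2 alpha lr b eps K ->
  (complexity p theta0 n b lr Delta0 L sigma2 eps <= K%:R%:E)%E.
Proof.
move=> L0 s20 al2 b0 K0 e0 p12 lr_bound hK.
apply: ge_ereal_sup => y /= -[dO] [dX] [T] [Xi] [P] [G] [xi] [f] [fstar].
move=> [obj orc ->].
exact: (iterations_le L0 s20 obj orc b0 p12 K0 e0 al2 lr_bound hK).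
Qed.

Lemma complexity_order (R : realType) (d : nat) (L Delta0 sigma2 alpha eps0 gap : R)
    (theta0 : 'rV[R]_d) (s : schedule R) (p : nat) :
  0 < L -> 0 < Delta0 -> 0 <= sigma2 -> 0 < alpha -> L * alpha < 2 ->
  0 < eps0 -> schedule_ok s -> p = 1%N \/ p = 2%N ->
  exists2 c : R, 0 < c & forall n eps, 0 < eps <= eps0 ->
    (complexity p theta0 n (batch_size s alpha L sigma2 gap eps)
       (learning_rate s alpha) Delta0 L sigma2 eps <= (c * K_order s eps)%:E)%E.
Proof.
move=> L0 D0 s20 al0 al2 e00 ok p12.
have [c c0 hc] := schedule_enough gap L0 D0 s20 al0 al2 e00 ok.
have y0 := K_order_gt0 s e00.
(* Rounding [c * K_order s eps] to a positive integer adds at most 1, which is at most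
   [K_order s eps / K_order s eps0] because [eps <= eps0]. *)
exists (c + (K_order s eps0)^-1); first by rewrite ltr_wpDl ?invr_gt0.
move=> n eps e_bound; have /andP[e0 ee0] := e_bound.
pose K := (Num.truncn (c * K_order s eps)).+1.
have cK : c * K_order s eps <= K%:R by rewrite ltW// truncnS_gt.
have yle : 1 <= (K_order s eps0)^-1 * K_order s eps.
  by rewrite mulrC ler_pdivlMr// mul1r; exact: K_order_le e00 _ _ _ _.
apply: (@le_trans _ _ K%:R%:E).
  have lr_bound k := learning_rate_bound k al0 ok.
  apply: (complexity_le _ _ L0 s20 al2 _ (ltn0Sn _) e0 p12 lr_bound).
    exact: batch_size_gt0.
  exact: hc.
rewrite lee_fin mulrDl -natr1 lerD// truncn_le mulr_ge0//.
exact/ltW/K_order_gt0.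
Qed.

Lemma batch_order (R : realType) (L sigma2 alpha eps0 gap : R) (s : schedule R) :
  0 < L -> 0 <= sigma2 -> 0 < alpha -> L * alpha < 2 -> 0 < eps0 ->
  schedule_ok s ->
  exists2 c : R, 0 < c & forall eps, 0 < eps <= eps0 ->
    K_order s eps * (batch_size s alpha L sigma2 gap eps)%:R <= c * N_order s eps.
Proof.
move=> L0 s20 al0 al2 e00 ok.
(* The 2 lost in rounding the batch size is absorbed through [2 <= 2 * eps0^2 / eps^2]. *)
have bound (x eps : R) : 0 <= x -> 0 < eps <= eps0 ->
    x / eps ^+ 2 + 2 <= (x + 2 * eps0 ^+ 2) / eps ^+ 2.
  move=> x0 /andP[e0 ee0]; rewrite mulrDl lerD2l ler_pdivlMr ?exprn_gt0//.
  by rewrite ler_pM2l// ler_sqr ?nnegrE ?(ltW e0) ?(ltW e00).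
have ab0 : 0 < 2 - L * alpha by rewrite subr_gt0.
have e20 : 0 < 2 * eps0 ^+ 2 by rewrite mulr_gt0 ?exprn_gt0.
case: s ok => [_|T a _|T T1|T a _].
- have C0 : 0 <= 2 * C2 alpha L sigma2.
    by rewrite mulr_ge0// divr_ge0 ?(ltW ab0)// !mulr_ge0// ltW.
  exists (2 * C2 alpha L sigma2 + 2 * eps0 ^+ 2); first by rewrite ltr_wpDl.
  move=> eps ebound; have /andP[e0 ee0] := ebound.
  have x0 : 0 <= bstar Constant alpha L sigma2 gap eps.
    by rewrite /= divr_ge0// sqr_ge0.
  rewrite /= (_ : (eps ^+ 4)^-1 = (eps ^+ 2)^-1 * (eps ^+ 2)^-1); last first.
    by rewrite -invfM -exprD.
  rewrite mulrCA ler_pM2l ?invr_gt0 ?exprn_gt0//.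
  exact: le_trans (batch_size_le x0) (bound _ _ C0 ebound).
(* For this schedule [bstar] does not depend on [eps], so its value at 1 gives the constant; the
   same holds for [Decay3]. *)
- exists (batch_size (Decay1 T a) alpha L sigma2 gap 1)%:R.
    by rewrite ltr0n batch_size_gt0.
  by move=> eps _; rewrite mulrC.
- have C0 : 0 <= D2 alpha L sigma2 T + 1.
    rewrite addr_ge0// divr_ge0 ?(ltW ab0)// !mulr_ge0 ?(ltW L0) ?(ltW al0)//.
    exact: le_trans T1.
  exists (D2 alpha L sigma2 T + 1 + 2 * eps0 ^+ 2); first by rewrite ltr_wpDl.
  move=> eps ebound; have /andP[e0 ee0] := ebound.
  have x0 : 0 <= bstar (Decay2 T) alpha L sigma2 gap eps.
    by rewrite /= divr_ge0// sqr_ge0.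
  rewrite /= (_ : (eps ^+ 6)^-1 = (eps ^+ 4)^-1 * (eps ^+ 2)^-1); last first.
    by rewrite -invfM -exprD.
  rewrite mulrCA ler_pM2l ?invr_gt0 ?exprn_gt0//.
  exact: le_trans (batch_size_le x0) (bound _ _ C0 ebound).
- exists (batch_size (Decay3 T a) alpha L sigma2 gap 1)%:R.
    by rewrite ltr0n batch_size_gt0.
  by move=> eps _; rewrite mulrC.
Qed.

(** The given [f] enters the batch size only through its gap, while the complexities range over the
    whole class; the bounds hold for any value of that gap. The cap [eps0] on [eps] absorbs the
    integer rounding of the iteration count and of the batch size. *)
Theorem theorem3p4 (R : realType) (d : nat) (L Delta0 sigma2 alpha : R)
    (theta0 : 'rV[R]_d) (f : 'rV[R]_d -> R) (fstar : R) (s : schedule R)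
    (L_gt0 : 0 < L) (Delta0_gt0 : 0 < Delta0) (sigma2_ge0 : 0 <= sigma2)
    (alpha_bound : 0 < alpha < 2 / L) (s_ok : schedule_ok s)
    (eps0 : R) (eps0_gt0 : 0 < eps0) :
  let lr := learning_rate s alpha in
  let b := batch_size s alpha L sigma2 (f theta0 - fstar) in
  let A := [set i : R * nat |
    [/\ 0 < i.1 <= eps0,
        objective i.2 Delta0 L theta0 fstar f &
        (b i.1 <= i.2)%N]] in
  [/\ bigO_on A (fun i => K_eps theta0 i.2 (b i.1) lr Delta0 L sigma2 i.1)
                (fun i => K_order s i.1),
      bigO_on A (fun i => N_eps theta0 i.2 (b i.1) lr Delta0 L sigma2 i.1)
                (fun i => N_order s i.1),
      bigO_on A (fun i => K_approx theta0 i.2 (b i.1) lr Delta0 L sigma2 i.1)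
                (fun i => K_order s i.1) &
      bigO_on A (fun i => N_approx theta0 i.2 (b i.1) lr Delta0 L sigma2 i.1)
                (fun i => N_order s i.1)].
Proof.
move=> lr b A.
have /andP[al0 alL] := alpha_bound.
have al2 : L * alpha < 2 by rewrite mulrC -ltr_pdivlMr.
have K_bound p (p12 : p = 1%N \/ p = 2%N) := complexity_order
  (f theta0 - fstar) theta0 L_gt0 Delta0_gt0 sigma2_ge0 al0 al2 eps0_gt0 s_ok p12.
have [cb cb0 hb] := batch_order (f theta0 - fstar) L_gt0 sigma2_ge0 al0 al2 eps0_gt0 s_ok.
have K_bigO p : p = 1%N \/ p = 2%N -> bigO_on A
    (fun i => complexity p theta0 i.2 (b i.1) lr Delta0 L sigma2 i.1)
    (fun i => K_order s i.1).
  by move=> /K_bound[c c0 hc]; exists c => // i [ebound _ _]; exact: hc.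
have N_bigO p : p = 1%N \/ p = 2%N -> bigO_on A
    (fun i => complexity p theta0 i.2 (b i.1) lr Delta0 L sigma2 i.1 * (b i.1)%:R%:E)%E
    (fun i => N_order s i.1).
  move=> /K_bound[c c0 hc]; exists (c * cb); first exact: mulr_gt0.
  move=> i [ebound _ _].
  apply: (@le_trans _ _ ((c * K_order s i.1)%:E * (b i.1)%:R%:E)%E).
    by apply: lee_wpmul2r; [rewrite lee_fin|exact: hc].
  rewrite -EFinM lee_fin -!mulrA ler_pM2l//; exact: hb.
by split; [apply: K_bigO|apply: N_bigO|apply: K_bigO|apply: N_bigO]; by [left|right].
Qed.
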